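(* If the 2FRP problem in undirected weighted graphs with $n$ vertices can be solved in $O(n^{3-\epsilon})$ time for some $\epsilon>0$, then the all-pairs shortest path problem in undirected weighted graphs with $n$ vertices can also be solved in $O(n^{3-\epsilon})$ time.
   Context: The 2-fault replacement path (2FRP) problem: given an undirected weighted graph $G$ and vertices $s,t$, compute for every set $F$ of at most two edges the length of the shortest $s$-$t$ path in $G-F$ ($G$ with the edges of $F$ removed); equivalently, for every edge $d_1$ on the shortest $s$-$t$ path of $G$ and every edge $d_2$ on the shortest $s$-$t$ path of $G-\{d_1\}$, the length of the shortest $s$-$t$ path in $G-\{d_1,d_2\}$. *)

(* Defs.v *)
From mathcomp Require Import all_boot all_order all_algebra.
From mathcomp Require Import reals exp.

Set Implicit Arguments.
Unset Strict Implicit.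
Unset Printing Implicit Defensive.

Import Order.TTheory GRing.Theory Num.Theory.

(** * Word RAM *)

(* Programs work on finitely many registers and a memory addressed by words;
   registers and memory cells hold words of w bits.  Control flow is
   structured; a machine with jumps is simulated with constant-factor overhead
   by a loop dispatching on a register that holds the program counter. *)

Inductive binop :=
  | Add | Sub | Mul | Div | And | Or | Xor | Shl | Shr | Lt | Eq.

Inductive cmd :=
  | Skip
  | Const of nat & nat               (* Const r k     r := k        *)
  | Bin of binop & nat & nat & nat   (* Bin o r a b   r := o a b    *)
  | Read of nat & nat                (* Read r a      r := mem[a]   *)
  | Write of nat & nat               (* Write a r     mem[a] := r   *)
  | Seq of cmd & cmd
  | If of nat & cmd & cmd            (* register <> 0 means true    *)
  | While of nat & cmd.

Record state := State { reg : nat -> nat; mem : nat -> nat }.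

Definition upd (f : nat -> nat) (x v : nat) : nat -> nat :=
  fun y => if y == x then v else f y.

Definition set_reg (st : state) (r v : nat) : state :=
  State (upd (reg st) r v) (mem st).

Definition set_mem (st : state) (a v : nat) : state :=
  State (reg st) (upd (mem st) a v).

(* All operations are on w-bit words, i.e. modulo 2 ^ w. *)
Definition binop_val (w : nat) (o : binop) (a b : nat) : nat :=
  match o with
  | Add => a + b
  | Sub => a + (2 ^ w - b)
  | Mul => a * b
  | Div => a %/ b
  | And => Nat.land a b
  | Or => Nat.lor a b
  | Xor => Nat.lxor a b
  | Shl => a * 2 ^ b
  | Shr => a %/ 2 ^ b
  | Lt => a < b
  | Eq => a == b
  end %% 2 ^ w.

(* [exec w c st t st'] : with word size w, program c started in st halts in st'
   after t steps, each elementary instruction and each test costing one step. *)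
Inductive exec (w : nat) : cmd -> state -> nat -> state -> Prop :=
  | ExecSkip st : exec w Skip st 1 st
  | ExecConst st r k :
      exec w (Const r k) st 1 (set_reg st r (k %% 2 ^ w))
  | ExecBin st o r a b :
      exec w (Bin o r a b) st 1
        (set_reg st r (binop_val w o (reg st a) (reg st b)))
  | ExecRead st r a :
      exec w (Read r a) st 1 (set_reg st r (mem st (reg st a)))
  | ExecWrite st a r :
      exec w (Write a r) st 1 (set_mem st (reg st a) (reg st r))
  | ExecSeq c1 c2 st1 st2 st3 t1 t2 :
      exec w c1 st1 t1 st2 -> exec w c2 st2 t2 st3 ->
      exec w (Seq c1 c2) st1 (t1 + t2) st3
  | ExecIfTrue r c1 c2 st st' t :
      reg st r != 0 -> exec w c1 st t st' -> exec w (If r c1 c2) st t.+1 st'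
  | ExecIfFalse r c1 c2 st st' t :
      reg st r = 0 -> exec w c2 st t st' -> exec w (If r c1 c2) st t.+1 st'
  | ExecWhileTrue r c st1 st2 st3 t1 t2 :
      reg st1 r != 0 -> exec w c st1 t1 st2 ->
      exec w (While r c) st2 t2 st3 ->
      exec w (While r c) st1 (t1 + t2).+1 st3
  | ExecWhileFalse r c st :
      reg st r = 0 -> exec w (While r c) st 1 st.

Definition init_state (x : seq nat) : state := State (fun=> 0) (nth 0 x).

(** * Computational problems and their time complexity *)

(* [correct I out] : the list of numbers out is a correct output on I. *)
Record problem := Problem {
  instance : Type;
  nverts : instance -> nat;
  input : instance -> seq nat;
  correct : instance -> seq nat -> Prop }.

(* Time is measured as a function of the number n of vertices.  A single
   program must work for every word size w that is at least a constant factor k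
   times the logarithm of the size and of the largest number of the input
   (so words of O(log n) bits when the weights are polynomial in n). *)
Definition solvable_in_O (R : realType) (P : problem) (T : nat -> R) : Prop :=
  exists (c : cmd) (k : nat) (C : R), (0 < k)%N /\
    forall (I : instance P) (w : nat), (0 < nverts I)%N ->
      ((size (input I) + \max_(a <- input I) a + 2) ^ k <= 2 ^ w)%N ->
      exists (t : nat) (st : state) (out : seq nat),
        [/\ exec w c (init_state (input I)) t st,
            (t%:R <= C * T (nverts I))%R,
            correct I out,
            (size out <= 2 ^ w)%N
          & forall i, (i < size out)%N -> mem st i = nth 0%N out i].

(** * Undirected weighted graphs *)

(* [g u v] is the weight of the edge uv, [None] if there is no such edge. *)
Definition weighting (n : nat) := 'I_n -> 'I_n -> option nat.

Record wgraph (n : nat) := WGraph {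
  weight :> weighting n;
  weight_sym : forall u v, weight u v = weight v u;
  weight_irr : forall u, weight u u = None }.

Section Paths.
Variables (n : nat) (g : weighting n).
Implicit Types (s t : 'I_n) (p : seq 'I_n).

Definition adj : rel 'I_n := fun u v => g u v != None.

(* As in [path], a path is given by its first vertex s and the list p of its
   further vertices. *)
Definition is_path s t p : Prop :=
  [/\ path adj s p, last s p = t & uniq (s :: p)].

Definition path_edges s p : seq ('I_n * 'I_n) := zip (s :: p) p.

Definition path_length s p : nat :=
  \sum_(e <- path_edges s p) odflt 0 (g e.1 e.2).

Definition shortest_path s t p : Prop :=
  is_path s t p /\
  forall q, is_path s t q -> path_length s p <= path_length s q.

(* [None] stands for the infinite distance. *)
Definition is_dist s t (d : option nat) : Prop :=
  if d is Some l then exists2 p, shortest_path s t p & l = path_length s p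
  else forall p, ~ is_path s t p.

End Paths.

(* A set of undirected edges is represented by a list of pairs in which the
   order of the pairs and the orientation of each pair are irrelevant. *)
Definition in_faults n (F : seq ('I_n * 'I_n)) (u v : 'I_n) : bool :=
  ((u, v) \in F) || ((v, u) \in F).

Definition remove n (g : weighting n) (F : seq ('I_n * 'I_n)) : weighting n :=
  fun u v => if in_faults F u v then None else g u v.

(** * Input and output conventions *)

Definition enc (d : option nat) : nat := if d is Some l then l.+1 else 0.

(* row-major *)
Definition enc_matrix n (g : weighting n) : seq nat :=
  [seq enc (g u v) | u <- enum 'I_n, v <- enum 'I_n].

(** * All-pairs shortest paths *)

Record apsp_instance := ApspInstance {
  apsp_n : nat;
  apsp_graph : wgraph apsp_n }.

Definition apsp_input (I : apsp_instance) : seq nat :=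
  apsp_n I :: enc_matrix (apsp_graph I).

Definition apsp_correct (I : apsp_instance) (out : seq nat) : Prop :=
  exists D : weighting (apsp_n I),
    (forall u v, is_dist (apsp_graph I) u v (D u v)) /\ out = enc_matrix D.

Definition apsp : problem := Problem apsp_n apsp_input apsp_correct.

(** * Replacement paths under edge faults *)

Record frp_instance := FrpInstance {
  frp_n : nat;
  frp_graph : wgraph frp_n;
  frp_s : 'I_frp_n;
  frp_t : 'I_frp_n }.

Definition frp_input (I : frp_instance) : seq nat :=
  [:: frp_n I, nat_of_ord (frp_s I), nat_of_ord (frp_t I)
    & enc_matrix (frp_graph I)].

Section Answers.
Variables (n : nat) (g : wgraph n) (s t : 'I_n).

(* A table of pairs (fault set F, s-t distance in g - F). *)
Definition table := seq (seq ('I_n * 'I_n) * option nat).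

Definition covered (tbl : table) (F : seq ('I_n * 'I_n)) : Prop :=
  exists2 e, e \in tbl & in_faults e.1 =2 in_faults F.

(* The table has an entry for F, and, as long as r > 0 further faults are
   allowed and t is reachable from s in g - F, there is a shortest s-t path of
   g - F such that the same holds for F + d, for every edge d of that path.
   For r = 2 and F empty these are: the empty set, {d1} for d1 on a shortest
   path P of g, and {d1, d2} for d2 on a shortest path of g - {d1}.  When
   shortest paths are not unique, the choice is left to the algorithm.  The
   distance for any F of size at most r is then the largest one recorded for a
   subset of F. *)
Fixpoint answered (tbl : table) (r : nat) (F : seq ('I_n * 'I_n)) : Prop :=
  covered tbl F /\
  if r is r'.+1 then
    (forall P, ~ is_path (remove g F) s t P) \/
    exists2 P, shortest_path (remove g F) s t P &
      forall d, d \in path_edges s P -> answered tbl r' (d :: F)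
  else True.

Definition table_correct (f : nat) (tbl : table) : Prop :=
  (forall e, e \in tbl ->
     size e.1 <= f /\ is_dist (remove g e.1) s t e.2) /\
  answered tbl f [::].

End Answers.

Definition enc_entry n (e : seq ('I_n * 'I_n) * option nat) : seq nat :=
  size e.1 ::
    flatten [seq [:: nat_of_ord d.1; nat_of_ord d.2] | d <- e.1] ++ [:: enc e.2].

Definition enc_table n (tbl : table n) : seq nat :=
  size tbl :: flatten (map (@enc_entry n) tbl).

Definition frp_correct (f : nat) (I : frp_instance) (out : seq nat) : Prop :=
  exists tbl : table (frp_n I),
    table_correct (frp_graph I) (frp_s I) (frp_t I) f tbl /\
    out = enc_table tbl.

Definition frp (f : nat) : problem := Problem frp_n frp_input (frp_correct f).

(* Main.v *)
(* Given a graph G on n vertices, attach to its vertices u_0, ..., u_{n-1} two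
   paths a_0 ... a_{n-1} and b_0 ... b_{n-1} of weight 0, joining a_i and b_i to
   u_i by edges of weight (2n - i) M, with M larger than all distances of G, and
   complete G by edges of weight M - 1.  Cutting the a-path after a_i and the
   b-path after b_j forces every cheap path from a_0 to b_0 to leave the a-path
   at a_i and to enter the b-path at b_j, so its length is d(u_i, u_j) plus a
   term that depends only on i and j; a potential function shows this.  The
   failures of at most two edges thus reveal all distances of G.

   The n^2 answers all exceed the numbers of the input, so any 2FRP algorithm
   has to write them one by one.  Hence n^2 is at most its running time, whatever
   eps is, and the overhead of the reduction is dominated by that of the call. *)
Require Import Defs.
From mathcomp Require Import all_boot all_order all_algebra.
From mathcomp Require Import boolp reals exp.
From mathcomp Require Import zify.
Import Order.TTheory GRing.Theory Num.Theory.
Set Implicit Arguments.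
Unset Strict Implicit.
Unset Printing Implicit Defensive.

(** * Total correctness of word RAM programs *)

Section TotalCorrectness.
Variable w : nat.

(** The factor [2n - i] serves twice. It drops by one per vertex, so leaving a path one vertex early
    costs an extra [M], more than any detour in G can save. The cheap route therefore uses every
    path edge before the cut, and each such edge must occur as a next fault in the table. It is also
    at least [n + 1], so two attachments together exceed the largest input number [2nM + 1].

    The obstacle is the freedom left to the 2FRP algorithm: it chooses among shortest paths, orders
    and orients faults as it likes, may repeat entries and may add unrelated ones. Hence the pair
    (i, j) is recomputed from every fault list, entries whose faults touch some u_i are skipped, and
    the number of entries is bounded through the running time. The edges of weight [M - 1] make all
    these answers finite; the truncated distance [M - 1] marks an unreachable pair. Since the table
    and the n^2 results must fit together into the addressable memory, the exponent in the word size
    condition depends on the constant of the assumed running time. *)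

Definition runs (c : cmd) (st : state) (T : nat) (Q : state -> Prop) : Prop :=
  exists t st', [/\ exec w c st t st', t <= T & Q st'].

Fixpoint block (cs : seq cmd) : cmd :=
  if cs is c :: cs' then Seq c (block cs') else Skip.

Lemma exec_seq_inv c1 c2 st t st' :
  exec w (Seq c1 c2) st t st' ->
  exists t1 t2 st1,
    [/\ exec w c1 st t1 st1, exec w c2 st1 t2 st' & t = t1 + t2].
Proof.
move=> ex; inversion ex as [| | | | |? ? ? st1 ? t1 t2 ? ?| | | |]; subst.
by exists t1, t2, st1.
Qed.

Lemma runs_weaken c st T T' (Q Q' : state -> Prop) :
  T <= T' -> (forall st', Q st' -> Q' st') ->
  runs c st T Q -> runs c st T' Q'.
Proof.
move=> le_T sQ [t [st' [ex le_t q]]]; exists t, st'; split=> //; last exact: sQ.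
exact: leq_trans le_T.
Qed.

Lemma runs_seq c1 c2 st T1 T2 Q1 Q :
  runs c1 st T1 Q1 -> (forall st1, Q1 st1 -> runs c2 st1 T2 Q) ->
  runs (Seq c1 c2) st (T1 + T2) Q.
Proof.
move=> [t1 [st1 [ex1 le1 q1]]] /(_ st1 q1) [t2 [st2 [ex2 le2 q2]]].
exists (t1 + t2), st2; split=> //; first exact: ExecSeq ex1 ex2.
exact: leq_add.
Qed.

Lemma runs_cons c cs st T1 T2 Q1 Q :
  runs c st T1 Q1 -> (forall st1, Q1 st1 -> runs (block cs) st1 T2 Q) ->
  runs (block (c :: cs)) st (T1 + T2) Q.
Proof. exact: runs_seq. Qed.

Lemma runs_nil st T (Q : state -> Prop) : Q st -> runs (block [::]) st T.+1 Q.
Proof. by move=> q; exists 1, st; split=> //; exact: ExecSkip. Qed.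

Lemma runs_cat cs1 cs2 st T Q :
  runs (block (cs1 ++ cs2)) st T Q ->
  runs (Seq (block cs1) (block cs2)) st T.+1 Q.
Proof.
elim: cs1 st T Q => [|c cs1 IH] st T Q /=.
  move=> [t [st' [ex le_t q]]]; exists (1 + t), st'; split=> //.
  exact: ExecSeq (ExecSkip _ _) ex.
move=> [t [st' [/exec_seq_inv [t1 [t2 [st1 [ex1 ex2 ->]]]] le_t q]]].
have /IH [t' [st2 []]] : runs (block (cs1 ++ cs2)) st1 t2 (eq st').
  by exists t2, st'.
move=> /exec_seq_inv [t3 [t4 [st3 [ex3 ex4 ->]]]] le_t' eq_st; subst st2.
exists ((t1 + t3) + t4), st'; split=> //; last by lia.
exact: ExecSeq (ExecSeq ex1 ex3) ex4.
Qed.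

(** The index of [Inv] counts the iterations still to come, so the invariant yields termination and
    the time bound at once. *)
Lemma runs_while r c T (Inv : nat -> state -> Prop) :
    (forall k st, Inv k.+1 st -> reg st r != 0 /\ runs c st T (Inv k)) ->
    (forall st, Inv 0 st -> reg st r = 0) ->
  forall k st, Inv k st -> runs (While r c) st (k * T.+1 + 1) (Inv 0).
Proof.
move=> step stop; elim=> [|k IH] st inv.
  by exists 1, st; split=> //; apply: ExecWhileFalse; exact: stop.
have [r_neq0 [t [st1 [ex le_t /IH]]]] := step _ _ inv.
move=> [t' [st2 [ex' le_t' q]]]; exists (t + t').+1, st2; split=> //.
  exact: ExecWhileTrue ex ex'.
by lia.
Qed.

(* States are split into the registers l of the caller, the registers h of a
   subroutine, which are numbered from [size l], and the memory. *)
Definition regs (l : seq nat) (h : nat -> nat) : nat -> nat :=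
  fun r => if r < size l then nth 0 l r else h (r - size l).

Definition mk l h m := State (regs l h) m.

Lemma upd_regs l h r v :
  r < size l -> upd (regs l h) r v = regs (set_nth 0 l r v) h.
Proof.
move=> lt_r; apply: funext => x; rewrite /upd /regs size_set_nth nth_set_nth /=.
have -> : maxn r.+1 (size l) = size l by lia.
by case: eqP => [->|]; rewrite ?lt_r.
Qed.

Lemma regs_lt l h r : r < size l -> regs l h r = nth 0 l r.
Proof. by rewrite /regs => ->. Qed.

Section Instructions.
Variables (l : seq nat) (h m : nat -> nat) (cs : seq cmd) (T : nat).
Variable Q : state -> Prop.

Let run := fun l m => runs (block cs) (mk l h m) T Q.

Lemma runs_instr c st st' :
  exec w c st 1 st' -> runs (block cs) st' T Q ->
  runs (block (c :: cs)) st T.+1 Q.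
Proof.
move=> ex [t [st2 [ex2 le_t q]]]; exists (1 + t), st2; split=> //.
exact: ExecSeq ex ex2.
Qed.

Lemma runs_const r k :
  r < size l -> k < 2 ^ w -> run (set_nth 0 l r k) m ->
  runs (block (Const r k :: cs)) (mk l h m) T.+1 Q.
Proof.
move=> lt_r lt_k ok; apply: runs_instr (ExecConst _ _ _ _) _.
by rewrite modn_small // /set_reg upd_regs.
Qed.

Lemma runs_bin o r a b v :
  [&& r < size l, a < size l & b < size l] ->
  binop_val w o (nth 0 l a) (nth 0 l b) = v ->
  run (set_nth 0 l r v) m ->
  runs (block (Bin o r a b :: cs)) (mk l h m) T.+1 Q.
Proof.
move=> /and3P [lt_r lt_a lt_b] ev ok; apply: runs_instr (ExecBin _ _ _ _ _ _) _.
by rewrite /set_reg /= !regs_lt // ev upd_regs.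
Qed.

Lemma runs_add r a b :
  [&& r < size l, a < size l & b < size l] ->
  nth 0 l a + nth 0 l b < 2 ^ w ->
  run (set_nth 0 l r (nth 0 l a + nth 0 l b)) m ->
  runs (block (Bin Add r a b :: cs)) (mk l h m) T.+1 Q.
Proof.
move=> lt_l lt_v; apply: (runs_bin (v := nth 0 l a + nth 0 l b)) => //.
by rewrite /binop_val modn_small.
Qed.

Lemma runs_sub r a b :
  [&& r < size l, a < size l & b < size l] ->
  nth 0 l b <= nth 0 l a < 2 ^ w ->
  run (set_nth 0 l r (nth 0 l a - nth 0 l b)) m ->
  runs (block (Bin Defs.Sub r a b :: cs)) (mk l h m) T.+1 Q.
Proof.
move=> lt_l /andP [le_v lt_v].
apply: (runs_bin (v := nth 0 l a - nth 0 l b)) => //.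
rewrite /binop_val addnBA; last exact: ltnW (leq_ltn_trans le_v lt_v).
by rewrite -addnBAC // modnDr modn_small //; apply: leq_ltn_trans lt_v; lia.
Qed.

Lemma runs_mul r a b :
  [&& r < size l, a < size l & b < size l] ->
  nth 0 l a * nth 0 l b < 2 ^ w ->
  run (set_nth 0 l r (nth 0 l a * nth 0 l b)) m ->
  runs (block (Bin Mul r a b :: cs)) (mk l h m) T.+1 Q.
Proof.
move=> lt_l lt_v; apply: (runs_bin (v := nth 0 l a * nth 0 l b)) => //.
by rewrite /binop_val modn_small.
Qed.

Lemma runs_div r a b :
  [&& r < size l, a < size l & b < size l] ->
  nth 0 l a < 2 ^ w ->
  run (set_nth 0 l r (nth 0 l a %/ nth 0 l b)) m ->
  runs (block (Bin Div r a b :: cs)) (mk l h m) T.+1 Q.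
Proof.
move=> lt_l lt_v; apply: (runs_bin (v := nth 0 l a %/ nth 0 l b)) => //.
rewrite /binop_val modn_small //.
exact: leq_ltn_trans (leq_div _ _) lt_v.
Qed.

Lemma runs_lt r a b :
  [&& r < size l, a < size l & b < size l] -> 1 < 2 ^ w ->
  run (set_nth 0 l r (nth 0 l a < nth 0 l b)) m ->
  runs (block (Bin Lt r a b :: cs)) (mk l h m) T.+1 Q.
Proof.
move=> lt_l lt_v; apply: (runs_bin (v := nth 0 l a < nth 0 l b)) => //.
rewrite /binop_val modn_small //.
exact: leq_ltn_trans (leq_b1 _) lt_v.
Qed.

Lemma runs_eq r a b :
  [&& r < size l, a < size l & b < size l] -> 1 < 2 ^ w ->
  run (set_nth 0 l r (nth 0 l a == nth 0 l b)) m ->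
  runs (block (Bin Eq r a b :: cs)) (mk l h m) T.+1 Q.
Proof.
move=> lt_l lt_v; apply: (runs_bin (v := nth 0 l a == nth 0 l b)) => //.
rewrite /binop_val modn_small //.
exact: leq_ltn_trans (leq_b1 _) lt_v.
Qed.

Lemma runs_read r a :
  (r < size l) && (a < size l) ->
  run (set_nth 0 l r (m (nth 0 l a))) m ->
  runs (block (Read r a :: cs)) (mk l h m) T.+1 Q.
Proof.
move=> /andP [lt_r lt_a] ok; apply: runs_instr (ExecRead _ _ _ _) _.
by rewrite /set_reg /= regs_lt // upd_regs.
Qed.

Lemma runs_write a r :
  (a < size l) && (r < size l) ->
  run l (upd m (nth 0 l a) (nth 0 l r)) ->
  runs (block (Write a r :: cs)) (mk l h m) T.+1 Q.
Proof.
move=> /andP [lt_a lt_r] ok; apply: runs_instr (ExecWrite _ _ _ _) _.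
by rewrite /set_mem /= !regs_lt.
Qed.

Lemma runs_if r cs1 cs2 :
  r < size l ->
  (nth 0 l r != 0 -> runs (block (cs1 ++ cs)) (mk l h m) T Q) ->
  (nth 0 l r = 0 -> runs (block (cs2 ++ cs)) (mk l h m) T Q) ->
  runs (block (If r (block cs1) (block cs2) :: cs)) (mk l h m) T.+2 Q.
Proof.
move=> lt_r ok1 ok2.
have regE : reg (mk l h m) r = nth 0 l r by rewrite /= /regs lt_r.
have [eq0|neq0] := eqVneq (nth 0 l r) 0.
  have [t [st [ex le_t q]]] := runs_cat (ok2 eq0).
  have [t1 [t2 [st1 [ex1 ex2 tE]]]] := exec_seq_inv ex; subst t.
  exists (t1.+1 + t2), st; split=> //.
  by apply: ExecSeq ex2; apply: ExecIfFalse ex1; rewrite regE.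
have [t [st [ex le_t q]]] := runs_cat (ok1 neq0).
have [t1 [t2 [st1 [ex1 ex2 tE]]]] := exec_seq_inv ex; subst t.
exists (t1.+1 + t2), st; split=> //.
by apply: ExecSeq ex2; apply: ExecIfTrue ex1; rewrite regE.
Qed.

End Instructions.

(** * Calling a program as a subroutine *)

Fixpoint shift (k : nat) (c : cmd) : cmd :=
  match c with
  | Skip => Skip
  | Const r x => Const (k + r) x
  | Bin o r a b => Bin o (k + r) (k + a) (k + b)
  | Read r a => Read (k + r) (k + a)
  | Write a r => Write (k + a) (k + r)
  | Seq c1 c2 => Seq (shift k c1) (shift k c2)
  | If r c1 c2 => If (k + r) (shift k c1) (shift k c2)
  | While r c => While (k + r) (shift k c)
  end.

Lemma regs_shift l h r : regs l h (size l + r) = h r.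
Proof. by rewrite /regs ltnNge leq_addr /= addKn. Qed.

Lemma set_reg_shift l st r v :
  set_reg (mk l (reg st) (Defs.mem st)) (size l + r) v =
  mk l (upd (reg st) r v) (Defs.mem st).
Proof.
rewrite /set_reg /mk /=; congr State; apply: funext => x; rewrite /upd /regs.
case: ltnP => lx; first by case: eqP => // ?; lia.
by have -> : (x == size l + r) = (x - size l == r) by lia.
Qed.

(** Registers are renumbered from [size l] on, so those of the caller survive whatever the called
    program uses; the memory is shared. *)
Lemma exec_shift l c st t st' :
  exec w c st t st' ->
  exec w (shift (size l) c) (mk l (reg st) (Defs.mem st)) t
    (mk l (reg st') (Defs.mem st')).
Proof.
have regE st0 r : regs l (reg st0) (size l + r) = reg st0 r.
  by exact: regs_shift.
elim=> {c st t st'} /=.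
- by move=> st; exact: ExecSkip.
- by move=> st r k; rewrite -set_reg_shift; exact: ExecConst.
- move=> st o r a b; rewrite -set_reg_shift.
  by rewrite -!(regE st); exact: ExecBin.
- move=> st r a; rewrite -set_reg_shift.
  by rewrite -!(regE st); exact: ExecRead.
- move=> st a r.
  have := ExecWrite w (mk l (reg st) (Defs.mem st)) (size l + a) (size l + r).
  by rewrite /set_mem /= !regE.
- by move=> c1 c2 st1 st2 st3 t1 t2 _ IH1 _ IH2; exact: ExecSeq IH1 IH2.
- by move=> r c1 c2 st st' t neq0 _ IH; apply: ExecIfTrue; rewrite /= ?regE.
- by move=> r c1 c2 st st' t eq0 _ IH; apply: ExecIfFalse; rewrite /= ?regE.
- move=> r c st1 st2 st3 t1 t2 neq0 _ IH1 _ IH2.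
  by apply: ExecWhileTrue IH1 IH2; rewrite /= regE.
- by move=> r c st eq0; apply: ExecWhileFalse; rewrite /= regE.
Qed.

(** * Cells written by a run *)

Lemma exec_written c st t st' :
  exec w c st t st' ->
  exists2 l : seq nat, size l <= t &
    forall a, a \notin l -> Defs.mem st' a = Defs.mem st a.
Proof.
elim=> {c st t st'}; try by move=> *; exists [::].
- move=> st a r; exists [:: reg st a] => // b; rewrite inE /= /upd.
  by case: eqP.
- move=> c1 c2 st1 st2 st3 t1 t2 _ [l1 le1 H1] _ [l2 le2 H2].
  exists (l1 ++ l2); first by rewrite size_cat leq_add.
  by move=> a; rewrite mem_cat negb_or => /andP [? ?]; rewrite H2 ?H1.
- by move=> r c1 c2 st st' t _ _ [l le_l H]; exists l => //; exact: leqW.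
- by move=> r c1 c2 st st' t _ _ [l le_l H]; exists l => //; exact: leqW.
- move=> r c st1 st2 st3 t1 t2 _ _ [l1 le1 H1] _ [l2 le2 H2].
  exists (l1 ++ l2); first by rewrite size_cat leqW // leq_add.
  by move=> a; rewrite mem_cat negb_or => /andP [? ?]; rewrite H2 ?H1.
Qed.

Lemma exec_pos c st t st' : exec w c st t st' -> 0 < t.
Proof. by elim=> // c1 c2 st1 st2 st3 t1 t2 _ ? _ ?; rewrite addn_gt0; lia. Qed.

(* An output cell satisfying P that is not among the cells s of the input has
   been written, and each write takes a step. *)
Lemma exec_count c st t st' (P : pred nat) (s out : seq nat) :
  exec w c st t st' ->
  (forall a, a \notin s -> ~~ P (Defs.mem st a)) ->
  (forall i, i < size out -> Defs.mem st' i = nth 0 out i) ->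
  count P out <= size s + t.
Proof.
move=> /exec_written [l le_l old] oldP outE.
apply: (@leq_trans (size (s ++ l))); last by rewrite size_cat leq_add2l.
have -> : count P out = size [seq i <- iota 0 (size out) | P (nth 0 out i)].
  by rewrite size_filter -[in LHS](mkseq_nth 0 out) /mkseq count_map.
apply: uniq_leq_size; first exact: filter_uniq (iota_uniq _ _).
move=> i; rewrite mem_filter mem_iota add0n /= => /andP [Pi lt_i].
rewrite mem_cat; apply: contraLR Pi; rewrite negb_or => /andP [s_i l_i].
by rewrite -outE // old // oldP.
Qed.

End TotalCorrectness.

(** * Walks and faults *)

Section Walks.
Variables (n : nat) (g : weighting n).
Implicit Types (u v x : 'I_n) (p : seq 'I_n).

Lemma path_length_cons u x p :
  path_length g u (x :: p) = odflt 0 (g u x) + path_length g x p.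
Proof. by rewrite /path_length /path_edges /= big_cons. Qed.

Lemma path_length_cat u p1 p2 :
  path_length g u (p1 ++ p2) =
  path_length g u p1 + path_length g (last u p1) p2.
Proof.
elim: p1 u => [|x p1 IH] u /=; first by rewrite {2}/path_length big_nil.
by rewrite !path_length_cons IH addnA.
Qed.

(** Walks, unlike simple paths, compose and can be mapped between graphs. As weights are
    nonnegative, removing loops leads back to simple paths without increasing the length. *)
Definition walk_le u v (L : nat) : Prop :=
  exists p, [/\ path (adj g) u p, last u p = v & path_length g u p <= L].

Lemma walk_le_refl u L : walk_le u u L.
Proof. by exists [::]; split=> //; rewrite /path_length big_nil. Qed.

Lemma walk_le_edge u v L : g u v = Some L -> walk_le u v L.
Proof.
move=> guv; exists [:: v]; split=> //=; first by rewrite /adj guv.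
by rewrite path_length_cons guv /path_length big_nil addn0.
Qed.

Lemma walk_le_trans u v x L1 L2 :
  walk_le u v L1 -> walk_le v x L2 -> walk_le u x (L1 + L2).
Proof.
move=> [p [p1 p2 p3]] [q [q1 q2 q3]]; exists (p ++ q); split.
- by rewrite cat_path p1 p2.
- by rewrite last_cat p2.
- by rewrite path_length_cat p2 leq_add.
Qed.

Lemma walk_leW u v L1 L2 : L1 <= L2 -> walk_le u v L1 -> walk_le u v L2.
Proof. by move=> le_L [p [? ? le_p]]; exists p; split=> //; lia. Qed.

Lemma walk_le_path u v L :
  walk_le u v L -> exists2 p, is_path g u v p & path_length g u p <= L.
Proof.
move=> [p [gp <- le_p]]; rewrite /is_path.
suff [q gq le_q] : exists2 q, is_path g u (last u p) q &
    path_length g u q <= path_length g u p by exists q => //; lia.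
elim: p u gp {le_p} => [|x p IH] u /=; first by exists [::].
move=> /andP [gux /IH [q [q1 q2 q3] le_q]].
(* Loop erasure: if [u] recurs on the simple path from [x], only the part after its occurrence is
   kept. *)
have [u_q|u_q] := boolP (u \in x :: q); last first.
  exists (x :: q); last by rewrite !path_length_cons leq_add2l.
  by split=> //=; [rewrite gux | rewrite u_q].
rewrite path_length_cons; move: u_q; rewrite inE => /predU1P [ux|u_q].
  by subst x; exists q => //; lia.
case/splitPr: q / u_q q1 q2 q3 le_q => [q1 q2].
rewrite cat_path last_cat -cat_cons cat_uniq path_length_cat path_length_cons.
move=> /andP [_ /= /andP [_ gq]] lq /andP [_ /andP [_ uq]] le_q.
by exists q2; [split | lia].
Qed.

Lemma is_dist_walk u v L :
  walk_le u v L -> (forall L', walk_le u v L' -> L <= L') ->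
  is_dist g u v (Some L).
Proof.
move=> /walk_le_path [p gp le_p] minL.
have lenE q : is_path g u v q -> L <= path_length g u q.
  by move=> [q1 q2 _]; apply: minL; exists q.
have pE : L = path_length g u p by apply/eqP; rewrite eqn_leq le_p lenE.
by exists p => //; split=> // q /lenE; rewrite pE.
Qed.

Lemma is_dist_exists u v : exists d, is_dist g u v d.
Proof.
have [[L0 w0]|nw] := pselect (exists L, walk_le u v L); last first.
  by exists None => p [? ? _]; apply: nw; exists (path_length g u p), p.
have ex : exists L, `[< walk_le u v L >] by exists L0; exact/asboolP.
case: (ex_minnP ex) => L /asboolP wL minL; exists (Some L).
by apply: is_dist_walk => // L' wL'; apply: minL; exact/asboolP.
Qed.

Lemma is_dist_SomeP u v L :
  is_dist g u v (Some L) ->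
  walk_le u v L /\ forall L', walk_le u v L' -> L <= L'.
Proof.
move=> [p [[p1 p2 p3] minp] ->]; split; first by exists p.
move=> L' /walk_le_path [q gq le_q]; exact: leq_trans (minp _ gq) le_q.
Qed.

Lemma is_dist_NoneP u v L : is_dist g u v None -> ~ walk_le u v L.
Proof. by move=> nop /walk_le_path [p gp _]; exact: nop gp. Qed.

Lemma is_dist_self u d : is_dist g u u d -> d = Some 0.
Proof.
have wu := walk_le_refl u 0; case: d => [L|] dL.
  by have [_ /(_ _ wu)] := is_dist_SomeP dL; case: L {dL}.
by case: (is_dist_NoneP dL wu).
Qed.

(** Weak duality for shortest paths: a feasible potential certifies a lower bound on every walk. *)
Lemma potential_le (phi : 'I_n -> nat) u p :
  (forall x y L, g x y = Some L -> phi y <= phi x + L) ->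
  path (adj g) u p -> phi (last u p) <= phi u + path_length g u p.
Proof.
move=> pot; elim: p u => [|x p IH] u /=; first by rewrite leq_addr.
rewrite path_length_cons /adj => /andP [].
case gux: (g u x) => [L|] //= _ /IH; have := pot _ _ _ gux; lia.
Qed.

Lemma path_length_le_sum u p :
  uniq (u :: p) ->
  path_length g u p <= \sum_(x : 'I_n) \sum_(y : 'I_n) odflt 0 (g x y).
Proof.
move=> up; rewrite pair_big /= /path_length.
(* No vertex is entered twice, so the edges already differ in their second components. *)
have ue : uniq (path_edges u p).
  apply: (@map_uniq _ _ snd); rewrite /path_edges; move: up => /= /andP [_].
  rewrite -/(unzip2 _) unzip2_zip //=; lia.
rewrite big_uniq //= [in leqRHS](bigID (mem (path_edges u p))) /=.
by rewrite leq_addr.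
Qed.

End Walks.

Lemma walk_le_map n k (g : weighting n) (h : weighting k) (f : 'I_n -> 'I_k)
    u v L :
  (forall x y l, g x y = Some l -> walk_le h (f x) (f y) l) ->
  walk_le g u v L -> walk_le h (f u) (f v) L.
Proof.
move=> emb [p [gp <- le_p]]; apply: walk_leW le_p _.
elim: p u gp => [|x p IH] u /=; first by move=> _; exact: walk_le_refl.
rewrite path_length_cons /adj => /andP []; case gux: (g u x) => [l|] //= _ gp.
exact: walk_le_trans (emb _ _ _ gux) (IH _ gp).
Qed.

(** * Faults and the edges a shortest path must use *)

Section Faults.
Variables (n : nat) (g : weighting n).
Implicit Types (u v : 'I_n) (F : seq ('I_n * 'I_n)).

Lemma in_faultsC F u v : in_faults F u v = in_faults F v u.
Proof. by rewrite /in_faults orbC. Qed.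

Lemma in_faults_cons d F u v :
  in_faults (d :: F) u v = (d == (u, v)) || (d == (v, u)) || in_faults F u v.
Proof.
rewrite /in_faults !inE -!(eq_sym d).
by case: (d == (u, v)); case: (d == (v, u)); rewrite ?orbT.
Qed.

Lemma path_avoid d F s p :
  path (adj (remove g F)) s p ->
  (forall e, e \in path_edges s p -> (e != d) && ((e.2, e.1) != d)) ->
  path (adj (remove g (d :: F))) s p /\
  path_length (remove g (d :: F)) s p = path_length (remove g F) s p.
Proof.
elim: p s => [|x p IH] s /=; first by rewrite /path_length !big_nil.
move=> /andP [gsx gp] av.
have [gp' lenE] : path (adj (remove g (d :: F))) x p /\
    path_length (remove g (d :: F)) x p = path_length (remove g F) x p.
  by apply: IH => // e ein; apply: av; rewrite /path_edges /= inE ein orbT.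
have /andP [d1 d2] := av (s, x) (mem_head _ _).
have rE : remove g (d :: F) s x = remove g F s x.
  rewrite /remove in_faults_cons -!(eq_sym _ d) (negPf d1).
  by rewrite [(x, s) == d](negPf d2).
by rewrite !path_length_cons /adj rE gp' lenE; split=> //; rewrite andbT.
Qed.

(** A shortest path avoiding [d] would survive its removal with length at most [X], below the new
    distance. This controls whichever shortest path the algorithm has chosen. *)
Lemma shortest_uses d F s t X Y P :
  shortest_path (remove g F) s t P ->
  walk_le (remove g F) s t X ->
  (forall L, walk_le (remove g (d :: F)) s t L -> Y <= L) -> X < Y ->
  exists2 e, e \in path_edges s P & e = d \/ (e.2, e.1) = d.
Proof.
move=> [[gP lP uP] minP] /walk_le_path [q gq le_q] low lt_XY.
have [/hasP [e ein /orP d_e]|/hasPn av] :=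
    boolP (has (fun e => (e == d) || ((e.2, e.1) == d)) (path_edges s P)).
  by exists e => //; case: d_e => /eqP; [left | right].
have [|gP' lenE] := path_avoid gP (d := d).
  by move=> e /av; rewrite negb_or.
have := low (path_length (remove g F) s P) _.
move=> /(_ _) Hlow; have {}Hlow : Y <= path_length (remove g F) s P.
  by apply: Hlow; exists P; split=> //; rewrite lenE.
by have := minP _ gq; lia.
Qed.

End Faults.

(** * The gadget *)

Arguments is_dist : simpl never.

Lemma size_enc_matrix n (g : weighting n) : size (enc_matrix g) = n * n.
Proof. by rewrite size_allpairs size_enum_ord. Qed.

Lemma nth_allpairs (S T U : Type) (f : S -> T -> U) x0 y0 z0 s t i j :
  i < size s -> j < size t ->
  nth z0 [seq f x y | x <- s, y <- t] (i * size t + j) =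
  f (nth x0 s i) (nth y0 t j).
Proof.
elim: s i => [|x s IH] [|i] //= lt_i lt_j; rewrite nth_cat size_map.
  by rewrite lt_j (nth_map y0).
rewrite mulSn -addnA ltnNge leq_addr /= addKn; exact: IH.
Qed.

Lemma nth_enc_matrix n (g : weighting n.+1) k :
  k < n.+1 * n.+1 ->
  nth 0 (enc_matrix g) k =
  enc (g (inord (k %/ n.+1)) (inord (k %% n.+1))).
Proof.
move=> lt_k; rewrite {1}(divn_eq k n.+1) -[X in _ * X + _](size_enum_ord n.+1).
have lt_i : k %/ n.+1 < n.+1 by rewrite ltn_divLR.
have lt_j : k %% n.+1 < n.+1 by rewrite ltn_pmod.
rewrite /enc_matrix (nth_allpairs _ ord0 ord0) ?size_enum_ord //.
congr (enc (g _ _)); apply: val_inj; rewrite /= nth_enum_ord // inordK //.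
Qed.

Lemma sumn_enc_matrix n (g : weighting n) :
  sumn (enc_matrix g) = \sum_(u : 'I_n) \sum_(v : 'I_n) enc (g u v).
Proof.
rewrite sumnE big_allpairs_dep /= big_enum /=.
by apply: eq_bigr => u _; rewrite big_enum.
Qed.

Definition gdist n (g : weighting n) : weighting n :=
  fun u v => sval (cid (is_dist_exists g u v)).

Lemma gdistP n (g : weighting n) u v : is_dist g u v (gdist g u v).
Proof. by rewrite /gdist; case: cid. Qed.

Definition dec (c : nat) : option nat := if c is c'.+1 then Some c' else None.

Lemma enc_dec c : enc (dec c) = c.
Proof. by case: c. Qed.

Lemma dec_Some c L : dec c = Some L -> c = L.+1.
Proof. by case: c => // c [->]. Qed.

(* The gadget has vertices a_i = i, b_i = n + i and u_i = 2 n + i for i < n;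
   this is the encoded weight of the edge from the i-th vertex of kind p to the
   j-th vertex of kind q. *)
Definition cell_of (n M : nat) (wt : nat -> nat -> nat) (p i q j : nat) : nat :=
  if p == q then
    if p == 2 then
      if i == j then 0 else if wt i j != 0 then wt i j else M
    else (i.+1 == j) + (j.+1 == i)
  else (1 < p + q) * (i == j) * ((2 * n - i) * M + 1).

Section Gadget.
Variables (m : nat) (G : wgraph m.+1).
Local Notation n := m.+1.
Local Notation N := (3 * m).+3.
Implicit Types (i j k p q : nat) (F : seq ('I_N * 'I_N)).

Definition apsp_cells : seq nat := apsp_input (ApspInstance G).

Definition wt i j : nat := enc (weight G (inord i) (inord j)).

(** The sum contains [n] and all encoded weights, so it bounds [n] and the length of every simple
    path of G; adding 2 makes even [heavy - 1] larger than both. *)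
Definition heavy : nat := (sumn apsp_cells).+2.
Arguments heavy : simpl never.

Definition cell : nat -> nat -> nat -> nat -> nat := cell_of n heavy wt.

Definition hcell (x y : nat) : nat :=
  cell (x %/ n) (x %% n) (y %/ n) (y %% n).

(** Cells hold weights plus one: 1 is a free path edge, [heavy] an added edge of weight [heavy - 1],
    and 0 no edge. The factor [1 < p + q] in [cell_of] rules out edges between the a-path and the
    b-path. *)
Definition hweight : weighting N := fun u v => dec (hcell u v).

Lemma wtC i j : wt i j = wt j i.
Proof. by rewrite /wt weight_sym. Qed.

Lemma hweightC u v : hweight u v = hweight v u.
Proof.
rewrite /hweight /hcell /cell /cell_of; congr dec.
move: (u %/ n) (v %/ n) (u %% n) (v %% n) => p q i j.
rewrite (eq_sym q) (addnC q) (eq_sym j i) wtC.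
case: eqP => [->|_]; first by rewrite [in RHS]addnC.
by case: eqP => [->|]; rewrite ?muln0.
Qed.

Lemma hweight_irr u : hweight u u = None.
Proof.
rewrite /hweight /hcell /cell /cell_of !eqxx; case: ifP => // _.
by have -> : (u %% n).+1 == u %% n = false by lia.
Qed.

Definition gadget : wgraph N := WGraph hweightC hweight_irr.

Definition vertex p i : 'I_N := inord (p * n + i).

Lemma vertexE p i : p < 3 -> i <= m -> vertex p i = p * n + i :> nat.
Proof. by move=> lt_p le_i; rewrite inordK //; nia. Qed.

Lemma vertex_surj (x : 'I_N) : exists p i, [/\ p < 3, i <= m & x = vertex p i].
Proof.
exists (x %/ n), (x %% n); split.
- by rewrite ltn_divLR //; have := ltn_ord x; lia.
- by rewrite -ltnS ltn_pmod.
- by apply: val_inj; rewrite /vertex /= -divn_eq inordK.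
Qed.

Local Opaque vertex.

Lemma hweight_vertex p i q j :
  p < 3 -> i <= m -> q < 3 -> j <= m ->
  hweight (vertex p i) (vertex q j) = dec (cell p i q j).
Proof.
move=> ? ? ? ?; rewrite /hweight /hcell !vertexE //.
by rewrite !divnMDl // !modnMDl !divn_small ?modn_small // !addn0.
Qed.

Definition frp_gadget : frp_instance :=
  FrpInstance gadget (vertex 0 0) (vertex 1 0).

(* Distances of G, truncated at the weight given to the missing edges. *)
Definition trunc_dist i j : nat := odflt heavy.-1 (gdist G (inord i) (inord j)).

Lemma gdist_lt u v L : gdist G u v = Some L -> L < heavy.-1.
Proof.
move=> dL; have := gdistP G u v; rewrite dL => -[p [[_ _ up] _] ->].
have := path_length_le_sum G up.
rewrite /heavy /apsp_cells /apsp_input /= sumn_enc_matrix.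
set s1 := (X in _ <= X -> _); set s2 := (X in _ + X).
suff : s1 <= s2 by lia.
by do 2![apply: leq_sum => ? _]; case: (weight G _ _) => //= ?; exact: leqnSn.
Qed.

Lemma trunc_dist_self i : trunc_dist i i = 0.
Proof. by rewrite /trunc_dist (is_dist_self (gdistP G _ _)). Qed.

Lemma trunc_dist_lt i j : trunc_dist i j < heavy.
Proof.
rewrite /trunc_dist; case E: (gdist _ _ _) => [L|] //=.
by have := gdist_lt E; lia.
Qed.

(** An added edge weighs [heavy - 1], the maximum of [trunc_dist]; for an edge of G this is the
    triangle inequality. So truncated distances are a feasible potential on the completed graph. *)
Lemma trunc_dist_step i j k L :
  j <= m -> k <= m -> dec (cell 2 j 2 k) = Some L ->
  trunc_dist i k <= trunc_dist i j + L.
Proof.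
move=> le_j le_k; rewrite /cell /cell_of /=; case: eqP => // ne_jk.
rewrite if_neg; case: eqP => [_|].
  by move=> /dec_Some ?; have := trunc_dist_lt i k; lia.
rewrite /wt; case Gjk: (weight G _ _) => [l|] //= _ [<-]; rewrite /trunc_dist.
have := gdistP G (inord i) (inord j); have := @gdist_lt (inord i) (inord k).
case: (gdist G _ (inord j)) => [a|] /=; last first.
  case: (gdist _ _ _) => [b|] /= => [/(_ b erefl)|_ _]; first by lia.
  exact: leq_addr.
move=> _ /is_dist_SomeP [wa _]; have wk := walk_le_trans wa (walk_le_edge Gjk).
have := gdistP G (inord i) (inord k).
case: (gdist _ _ _) => [b|] /= => [/is_dist_SomeP [_ /(_ _ wk)] //|].
by move=> /is_dist_NoneP /(_ wk).
Qed.

Definition attach i : nat := (2 * n - i) * heavy.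

Definition cost i j : nat := attach i + attach j + trunc_dist i j.

Lemma attach_lt i j : i < j -> j <= m -> attach j + heavy <= attach i.
Proof. by move=> lt_ij le_j; rewrite /attach -mulSnr leq_mul2r; lia. Qed.

Lemma attach_ge i : i <= m -> heavy <= attach i.
Proof. by move=> le_i; rewrite /attach leq_pmull //; lia. Qed.

(** Faults that touch no u_i: the copy of G and the attaching edges stay intact, and the distance
    depends on the two cuts alone. *)
Definition low_faults F : bool :=
  all (fun d : 'I_N * 'I_N => (d.1 < 2 * n) && (d.2 < 2 * n)) F.

(** [r] is the last vertex still reachable from the start along path [p]. The value [m] means an
    intact path, and nothing is required of the edges beyond the failed one. *)
Definition cut p F (r : nat) : Prop :=
  [/\ r <= m,
      forall k, k < r -> ~~ in_faults F (vertex p k) (vertex p k.+1)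
    & r < m -> in_faults F (vertex p r) (vertex p r.+1)].

Lemma low_faultsP F u v :
  low_faults F -> in_faults F u v -> (u < 2 * n) && (v < 2 * n).
Proof. by move=> /allP okF /orP [] /okF //=; rewrite andbC. Qed.

Lemma low_faults_top F p i j :
  low_faults F -> i <= m -> ~~ in_faults F (vertex 2 i) (vertex p j).
Proof.
move=> okF le_i; apply/negP => /(low_faultsP okF) /andP [].
by rewrite vertexE //; lia.
Qed.

(** * The distance from a_0 to b_0 for given cuts *)

Section Distance.
Variables (F : seq ('I_N * 'I_N)) (I J : nat).
Hypotheses (okF : low_faults F) (cutI : cut 0 F I) (cutJ : cut 1 F J).
Local Notation R := (remove hweight F).

Lemma remove_vertex p i q j :
  p < 3 -> i <= m -> q < 3 -> j <= m ->
  ~~ in_faults F (vertex p i) (vertex q j) ->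
  R (vertex p i) (vertex q j) = dec (cell p i q j).
Proof. by move=> *; rewrite /remove ifN // hweight_vertex. Qed.

Lemma prefix_walk p r i : p < 2 -> cut p F r -> i <= r ->
  walk_le R (vertex p 0) (vertex p i) 0 /\
  walk_le R (vertex p i) (vertex p 0) 0.
Proof.
move=> lt_p [le_r nof _]; elim: i => [|i IH] lt_i.
  by split; exact: walk_le_refl.
have [w1 w2] := IH (ltnW lt_i).
have e : dec (cell p i p i.+1) = Some 0 /\ dec (cell p i.+1 p i) = Some 0.
  rewrite /cell /cell_of !eqxx; have -> : (p == 2) = false by lia.
  by have -> : i.+2 == i = false by lia.
split.
- apply: (walk_le_trans (L1 := 0) (L2 := 0) w1); apply: walk_le_edge.
  rewrite remove_vertex ?e.1; by [reflexivity | lia | rewrite nof].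
- apply: (walk_le_trans (L1 := 0) (L2 := 0) _ w2); apply: walk_le_edge.
  rewrite remove_vertex ?e.2; by [reflexivity | lia | rewrite in_faultsC nof].
Qed.

Lemma top_edge j k : j <= m -> k <= m -> j != k ->
  walk_le R (vertex 2 j) (vertex 2 k) (cell 2 j 2 k).-1.
Proof.
move=> le_j le_k ne_jk; apply: walk_le_edge.
rewrite remove_vertex ?low_faults_top //.
by rewrite /cell /cell_of /= (negPf ne_jk); case: (wt j k).
Qed.

(** Shortest walks of G embed into the gadget, and an unreachable pair is joined directly by an
    added edge. *)
Lemma top_walk i j :
  i <= m -> j <= m -> walk_le R (vertex 2 i) (vertex 2 j) (trunc_dist i j).
Proof.
move=> le_i le_j; rewrite /trunc_dist; have := gdistP G (inord i) (inord j).
case E: (gdist _ _ _) => [L|] /= dL; last first.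
  have ne_ij : i != j.
    by apply/eqP => eq_ij; subst j; have := is_dist_self dL.
  apply: walk_leW (top_edge le_i le_j ne_ij).
  rewrite /cell /cell_of /= (negPf ne_ij).
  have := @walk_le_edge _ G (inord i) (inord j).
  rewrite /wt; case: (weight G _ _) => //= l.
  by move=> /(_ l erefl) /(is_dist_NoneP dL).
have [wL _] := is_dist_SomeP dL.
have /= := @walk_le_map _ _ G R (fun u => vertex 2 u) _ _ L _ wL.
rewrite !inordK //; apply=> x y l Gxy.
have le_x : x <= m by rewrite -ltnS.
have le_y : y <= m by rewrite -ltnS.
have ne_xy : (x : nat) != y.
  by apply/eqP => /val_inj xy; move: Gxy; rewrite xy weight_irr.
apply: walk_leW (top_edge le_x le_y ne_xy).
by rewrite /cell /cell_of /= (negPf ne_xy) /wt !inord_val Gxy.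
Qed.

Lemma attach_walk p i : p < 2 -> i <= m ->
  walk_le R (vertex p i) (vertex 2 i) (attach i) /\
  walk_le R (vertex 2 i) (vertex p i) (attach i).
Proof.
move=> lt_p le_i.
have e : dec (cell p i 2 i) = Some (attach i) /\
         dec (cell 2 i p i) = Some (attach i).
  rewrite /cell /cell_of eqxx (eq_sym 2); have -> : (p == 2) = false by lia.
  have -> : 1 < p + 2 by lia. have -> : 1 < 2 + p by lia.
  by rewrite !mul1n addn1.
split; apply: walk_le_edge.
  rewrite remove_vertex ?e.1;
    by [reflexivity | lia | rewrite in_faultsC low_faults_top].
rewrite remove_vertex ?e.2; by [reflexivity | lia | rewrite low_faults_top].
Qed.

Lemma gadget_walk : walk_le R (vertex 0 0) (vertex 1 0) (cost I J).
Proof.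
have [leI _ _] := cutI; have [leJ _ _] := cutJ.
have [w1 _] := prefix_walk (p := 0) isT cutI (leqnn _).
have [_ w5] := prefix_walk (p := 1) isT cutJ (leqnn _).
have [w2 _] := attach_walk (p := 0) isT leI.
have [_ w4] := attach_walk (p := 1) isT leJ.
have w3 := top_walk leI leJ.
have w123 := walk_le_trans (walk_le_trans w1 w2) w3.
have := walk_le_trans (walk_le_trans w123 w4) w5.
by apply: walk_leW; rewrite /cost; lia.
Qed.

(* The distance from a_0; on the two path segments that are cut off from a_0 and
   b_0 any value compatible with the edge weights would do. *)
Definition potential (x : 'I_N) : nat :=
  let i := x %% n in
  match x %/ n with
  | 0 => if i <= I then 0 else attach I
  | 1 => if i <= J then cost I J else attach I
  | _ => attach I + trunc_dist I i
  end.

Lemma potential_vertex p i : p < 3 -> i <= m ->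
  potential (vertex p i) =
  match p with
  | 0 => if i <= I then 0 else attach I
  | 1 => if i <= J then cost I J else attach I
  | _ => attach I + trunc_dist I i
  end.
Proof.
move=> ? ?; rewrite /potential vertexE // divnMDl // modnMDl divn_small //.
by rewrite modn_small // addn0.
Qed.

(** Passing between a path and the u_i is tight only at [I] and [J]. At earlier indices the
    attachment costs at least [heavy] more, which exceeds any truncated distance; beyond a cut the
    potentials differ by less than [heavy], and every attachment weighs at least that. *)
Lemma potential_edge x y L : R x y = Some L -> potential y <= potential x + L.
Proof.
have [p [i [lt_p le_i ->]]] := vertex_surj x.
have [q [j [lt_q le_j ->]]] := vertex_surj y.
rewrite /remove; case: ifP => // /negbT nof; rewrite hweight_vertex //.
have [leI _ fI] := cutI; have [leJ _ fJ] := cutJ.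
have tI := trunc_dist_self I; have ltI k := trunc_dist_lt I k.
have aI k : k <= m -> k < I -> attach I + heavy <= attach k.
  by move=> le_k ?; exact: attach_lt.
have aJ k : k <= m -> k < J -> attach J + heavy <= attach k.
  by move=> le_k ?; exact: attach_lt.
rewrite !potential_vertex //.
have [eq_pq|ne_pq] := eqVneq p q; last first.
  rewrite /cell /cell_of (negPf ne_pq); case: ltnP => //= lt_pq.
  case: eqP => [eq_ij|//]; subst j; rewrite !mul1n => /dec_Some.
  rewrite addn1 -/(attach i) => -[<-].
  have eqI : i = I -> attach i = attach I /\ trunc_dist I i = 0 by move=> ->.
  have eqJ : i = J -> attach i = attach J /\ trunc_dist I i = trunc_dist I J.
    by move=> ->.
  have := aI _ le_i; have := aJ _ le_i; have := attach_ge le_i.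
  have := ltI i; have := ltI J; move: eqI eqJ; rewrite /cost.
  move: (attach I) (attach J) (attach i) (trunc_dist I i) (trunc_dist I J).
  move: (heavy) => M a b c d e.
  clear -lt_p lt_q lt_pq ne_pq => *.
  have [[-> ->]|[[-> ->]|[[-> ->]|[-> ->]]]] : (p = 0 /\ q = 2) \/
    (p = 1 /\ q = 2) \/ (p = 2 /\ q = 0) \/ (p = 2 /\ q = 1) by lia.
  - by case: (leqP i I) => ?; lia.
  - by case: (leqP i J) => ?; lia.
  - by case: (leqP i I) => ?; lia.
  - by case: (leqP i J) => ?; lia.
subst q; have [p2|p2] := eqVneq p 2.
  by subst p => eL; have := trunc_dist_step I le_i le_j eL; lia.
rewrite /cell /cell_of eqxx (negPf p2) => /dec_Some eL.
have -> : L = 0 by lia.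
rewrite addn0.
(* A path edge between the two sides of the cut has failed, so both ends of a surviving one have the
   same potential. *)
have same r : cut p F r -> (i <= r) = (j <= r).
  move=> [le_r _ fr]; have [eq_ij|eq_ji] : i.+1 = j \/ j.+1 = i by lia.
    have ne_ir : i <> r.
      by move=> ir; move: nof; rewrite -eq_ij ir fr //; lia.
    by lia.
  have ne_jr : j <> r.
    by move=> jr; move: nof; rewrite in_faultsC -eq_ji jr fr //; lia.
  by lia.
have [p0|p1] : p = 0 \/ p = 1 by lia.
  by subst p; rewrite (same _ cutI).
by subst p; rewrite (same _ cutJ).
Qed.

Lemma gadget_walk_ge L : walk_le R (vertex 0 0) (vertex 1 0) L -> cost I J <= L.
Proof.
move=> [p [gp lp le_p]]; have := potential_le potential_edge gp.
rewrite lp !potential_vertex //= add0n => h; exact: leq_trans h le_p.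
Qed.

Lemma gadget_dist d :
  is_dist R (vertex 0 0) (vertex 1 0) d -> d = Some (cost I J).
Proof.
have w := gadget_walk; case: d => [L|] dL; last by case: (is_dist_NoneP dL w).
have [wL /(_ _ w) le_L] := is_dist_SomeP dL.
by congr Some; apply/eqP; rewrite eqn_leq le_L gadget_walk_ge.
Qed.

End Distance.

(** * Every pair of cuts occurs in the table *)

Lemma edge_eqE p k (d : 'I_N * 'I_N) : p < 3 -> k < m ->
  (d == (vertex p k, vertex p k.+1)) =
    ((d.1 : nat) == p * n + k) && ((d.2 : nat) == p * n + k.+1) /\
  (d == (vertex p k.+1, vertex p k)) =
    ((d.1 : nat) == p * n + k.+1) && ((d.2 : nat) == p * n + k).
Proof.
case: d => x y lt_p lt_k /=.
rewrite [LHS]xpair_eqE [X in _ /\ X = _]xpair_eqE -!val_eqE.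
by rewrite /= !vertexE //; lia.
Qed.

Lemma edge_faultE p k d F : p < 3 -> k < m ->
  in_faults (d :: F) (vertex p k) (vertex p k.+1) =
  ((d.1 : nat) == p * n + k) && ((d.2 : nat) == p * n + k.+1) ||
  ((d.1 : nat) == p * n + k.+1) && ((d.2 : nat) == p * n + k) ||
  in_faults F (vertex p k) (vertex p k.+1).
Proof.
by move=> lt_p lt_k; have [e1 e2] := edge_eqE d lt_p lt_k;
   rewrite in_faults_cons e1 e2.
Qed.

Definition is_edge p i (d : 'I_N * 'I_N) : bool :=
  ((d.1 : nat) == p * n + i) && ((d.2 : nat) == p * n + i.+1) ||
  ((d.1 : nat) == p * n + i.+1) && ((d.2 : nat) == p * n + i).

Lemma cut_cons p F r i d :
  p < 2 -> cut p F r -> i < r -> is_edge p i d -> cut p (d :: F) i.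
Proof.
move=> lt_p [le_r nof _] lt_i de; split=> [|k lt_k|lt_im]; first by lia.
  rewrite edge_faultE; try lia.
  rewrite negb_or nof ?andbT; last by lia.
  by move: de; rewrite /is_edge; lia.
by rewrite edge_faultE; [rewrite -/(is_edge p i d) de | lia | lia].
Qed.

Lemma cut_cons_neq p q F r i d :
  p < 2 -> q < 2 -> p != q -> cut p F r -> i < m -> is_edge q i d ->
  cut p (d :: F) r.
Proof.
move=> lt_p lt_q ne_pq [le_r nof fr] lt_i de.
have other k : k < m ->
    ((d.1 : nat) == p * n + k) && ((d.2 : nat) == p * n + k.+1) ||
    ((d.1 : nat) == p * n + k.+1) && ((d.2 : nat) == p * n + k) = false.
  move=> lt_k; move: de; rewrite /is_edge.
  have [[-> ->]|[-> ->]] : (p = 0 /\ q = 1) \/ (p = 1 /\ q = 0) by lia.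
    by lia.
  by lia.
split=> // [k lt_k|lt_r].
  by rewrite edge_faultE ?other ?nof //; lia.
by rewrite edge_faultE ?other ?fr //; lia.
Qed.

Lemma low_faults_cons p i d F : p < 2 -> i < m -> is_edge p i d ->
  low_faults F -> low_faults (d :: F).
Proof.
move=> lt_p lt_i de okF; apply/andP; split=> //; move: de; rewrite /is_edge.
have [->|->] : p = 0 \/ p = 1 by lia.
  by lia.
by lia.
Qed.

Lemma cut_unique p F r r' : cut p F r -> cut p F r' -> r = r'.
Proof.
move=> [le_r nof fr] [le_r' nof' fr']; case: (ltngtP r r') => // lt_r.
  by have := nof' _ lt_r; rewrite fr //; lia.
by have := nof _ lt_r; rewrite fr' //; lia.
Qed.

Lemma cut_eq p F F' r : in_faults F =2 in_faults F' -> cut p F' r -> cut p F r.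
Proof.
move=> eqF [le_r nof fr]; split=> // [k lt_k|lt_r].
  by rewrite eqF nof.
by rewrite eqF fr.
Qed.

Lemma low_faults_eq F F' :
  in_faults F =2 in_faults F' -> low_faults F' -> low_faults F.
Proof.
move=> eqF okF'; apply/allP => d dF; apply: (low_faultsP okF').
by rewrite -eqF /in_faults -surjective_pairing dF.
Qed.

Lemma cost_lt i i' j : i < i' -> i' <= m -> cost i' j < cost i j.
Proof.
move=> lt_i /(attach_lt lt_i); rewrite /cost.
by have := trunc_dist_lt i' j; lia.
Qed.

Lemma cost_lt_r i j j' : j < j' -> j' <= m -> cost i j' < cost i j.
Proof.
move=> lt_j /(attach_lt lt_j); rewrite /cost.
by have := trunc_dist_lt i j'; lia.
Qed.

Local Notation ans := (answered gadget (vertex 0 0) (vertex 1 0)).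

Lemma answered_covered tbl r F : ans tbl r F -> covered tbl F.
Proof. by case: r => [|r] []. Qed.

(** Cutting earlier strictly raises the distance, because the extra [heavy] outweighs any change of
    [trunc_dist]. So the i-th edge lies on the shortest path behind the table, and failing it is
    answered too. That path may traverse it in either direction, hence the existential [d]. *)
Lemma answered_step tbl r F I J p i :
  low_faults F -> cut 0 F I -> cut 1 F J -> p < 2 ->
  i < (if p == 0 then I else J) ->
  ans tbl r.+1 F ->
  exists d, [/\ ans tbl r (d :: F), low_faults (d :: F) &
    cut 0 (d :: F) (if p == 0 then i else I) /\
    cut 1 (d :: F) (if p == 0 then J else i)].
Proof.
move=> okF cI cJ lt_p lt_i [_ [nop|[P minP ansP]]].
  have [q gq _] := walk_le_path (gadget_walk okF cI cJ).
  by case: (nop q gq).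
have [leI _ _] := cI; have [leJ _ _] := cJ.
have lt_im : i < m by case: ifP lt_i => _; lia.
have cutd d : is_edge p i d -> [/\ low_faults (d :: F),
    cut 0 (d :: F) (if p == 0 then i else I) &
    cut 1 (d :: F) (if p == 0 then J else i)].
  move=> de; split; first exact: low_faults_cons de okF.
    have [p0|p1] : p = 0 \/ p = 1 by lia.
      by subst p; apply: cut_cons cI lt_i de.
    by subst p; apply: cut_cons_neq cI lt_im de.
  have [p0|p1] : p = 0 \/ p = 1 by lia.
    by subst p; apply: cut_cons_neq cJ lt_im de.
  by subst p; apply: cut_cons cJ lt_i de.
have de : is_edge p i (vertex p i, vertex p i.+1).
  by rewrite /is_edge /= !vertexE ?eqxx //; lia.
have [okd cd0 cd1] := cutd _ de.
have [|e eP e_d] := @shortest_uses _ _ _ F _ _ (cost I J)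
  (cost (if p == 0 then i else I) (if p == 0 then J else i)) P minP
  (gadget_walk okF cI cJ) (fun L => @gadget_walk_ge _ _ _ okd cd0 cd1 L).
  by case: ifP lt_i => _ lt_i; [exact: cost_lt | exact: cost_lt_r].
have ee : is_edge p i e.
  case: e_d de => [->//|]; case: (e) => x y /= <-.
  by rewrite /is_edge /= orbC andbC [X in _ || X]andbC.
by have [oke ce0 ce1] := cutd e ee; exists e; split; [exact: ansP | |].
Qed.

Lemma table_covers tbl i j :
  table_correct gadget (vertex 0 0) (vertex 1 0) 2 tbl -> i <= m -> j <= m ->
  exists2 e, e \in tbl & [/\ low_faults e.1, cut 0 e.1 i & cut 1 e.1 j].
Proof.
move=> [_ ans0] le_i le_j.
have cut0 p : cut p [::] m by split=> //; rewrite ltnn.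
suff [F [r /answered_covered [e eT eF] [okF cI cJ]]] : exists F,
    exists2 r, ans tbl r F & [/\ low_faults F, cut 0 F i & cut 1 F j].
  by exists e => //; split;
     [exact: low_faults_eq okF | exact: cut_eq cI | exact: cut_eq cJ].
have [F [r ansF [okF cI cJ]]] : exists F,
    exists2 r, ans tbl r.+1 F & [/\ low_faults F, cut 0 F i & cut 1 F m].
  (* A cut at [m] is the uncut path and uses up no fault. *)
  have [->|ne_im] := eqVneq i m; first by exists [::], 1.
  have lt_im : i < m by lia.
  have [d [ansd okd [cI cJ]]] := @answered_step tbl 1 [::] m m 0 i
    isT (cut0 0) (cut0 1) isT lt_im ans0.
  by exists [:: d], 0.
have [->|ne_jm] := eqVneq j m; first by exists F, r.+1.
have lt_jm : j < m by lia.
have [d [ansd okd [cI' cJ']]] := @answered_step tbl r F i m 1 j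
  okF cI cJ isT lt_jm ansF.
by exists (d :: F), r.
Qed.

(** * Recovering the cuts from a fault list *)

Definition cut_step p (r x y : nat) : nat :=
  if (x.+1 == y) && ((p * n <= x) && (x < p * n + r)) then x - p * n else r.

(** An executable form of [cut]: the least failed position, whatever the order and orientation of
    the faults. The last a-vertex and b_0 have consecutive numbers; the test [x < p * n + r] with
    [r <= m] keeps this pair from being taken for a path edge. *)
Definition scan p r F : nat :=
  foldl (fun r (d : 'I_N * 'I_N) =>
    cut_step p (cut_step p r d.1 d.2) d.2 d.1) r F.

Lemma scan_le p r F : r <= m -> scan p r F <= r.
Proof.
elim: F r => [|d F IH] r le_r //=.
have le_c q x y : q <= m -> cut_step p q x y <= q.
  by rewrite /cut_step; case: ifP; lia.
have le1 := le_c _ d.1 d.2 le_r.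
have le2 := le_c _ d.2 d.1 (leq_trans le1 le_r).
by have := IH _ (leq_trans le2 (leq_trans le1 le_r)); rewrite /scan; lia.
Qed.

Lemma scan_cut p F : p < 2 -> cut p F (scan p m F).
Proof.
move=> lt_p.
(* Generalized over the accumulator of the fold, which only decreases. *)
suff H r : r <= m -> (forall k, k < scan p r F -> k < r ->
      ~~ in_faults F (vertex p k) (vertex p k.+1)) /\
    (scan p r F < r ->
      in_faults F (vertex p (scan p r F)) (vertex p (scan p r F).+1)).
  have [nof fr] := H m (leqnn _); have le_s := @scan_le p m F (leqnn _).
  by split=> // k lt_k; apply: nof => //; exact: leq_trans lt_k le_s.
elim: F r => [|d F IH] r le_r //=; first by rewrite ltnn.
set r' := cut_step p (cut_step p r d.1 d.2) d.2 d.1.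
have le_r' : r' <= r.
  rewrite /r' /cut_step; do 2!case: ifP; lia.
have dE : forall k, k < m -> k < r' -> is_edge p k d = false.
  move=> k lt_k; rewrite /r' /cut_step /is_edge; do 2!case: ifP; lia.
have dE' : r' < r -> is_edge p r' d.
  by rewrite /r' /cut_step /is_edge; do 2!case: ifP; lia.
have [nof fr] := IH r' (leq_trans le_r' le_r).
have le_s := @scan_le p r' F (leq_trans le_r' le_r).
rewrite -/(scan p r' F).
split=> [k lt_k lt_kr|lt_r].
  rewrite edge_faultE; try lia.
  rewrite -/(is_edge p k d) dE; try lia.
  by apply: nof; lia.
rewrite edge_faultE; try lia.
have [eq_s|ne] := eqVneq (scan p r' F) r'.
  by rewrite eq_s; apply/orP; left; apply: dE'; rewrite -eq_s.
by apply/orP; right; apply: fr; lia.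
Qed.

Lemma table_scan tbl i j :
  table_correct gadget (vertex 0 0) (vertex 1 0) 2 tbl -> i <= m -> j <= m ->
  exists2 e, e \in tbl &
    [/\ low_faults e.1, scan 0 m e.1 = i & scan 1 m e.1 = j].
Proof.
move=> tblP le_i le_j; have [e eT [okF cI cJ]] := table_covers tblP le_i le_j.
by exists e => //; split=> //; [apply: cut_unique cI | apply: cut_unique cJ];
   exact: scan_cut.
Qed.

(** This concerns all entries with low faults, not only those known to exist, so entries with equal
    cuts agree and their order is irrelevant. *)
Lemma table_dist tbl e :
  table_correct gadget (vertex 0 0) (vertex 1 0) 2 tbl ->
  e \in tbl -> low_faults e.1 ->
  e.2 = Some (cost (scan 0 m e.1) (scan 1 m e.1)).
Proof.
move=> [tblP _] /tblP [_ de] okF.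
by apply: gadget_dist de => //; exact: scan_cut.
Qed.

(** Decoding without a branch: the truncated value [heavy - 1] is multiplied by 0, the code of an
    infinite distance. *)
Lemma enc_gdist i j :
  ((trunc_dist i j).+1 < heavy) * (trunc_dist i j).+1 =
  enc (gdist G (inord i) (inord j)).
Proof.
rewrite /trunc_dist; case E: (gdist _ _ _) => [L|]; rewrite /odflt /oapp /enc.
  have -> : L.+1 < heavy by have := gdist_lt E; lia.
  by rewrite mul1n.
by rewrite prednK // ltnn.
Qed.

(** * Entries and large numbers in the output *)

(** An entry starts with its nonzero number of faults, or has no fault and then ends with the
    nonzero code of a finite distance. Nonzero cells outside the input must have been written, which
    makes the number of entries a matter of time. *)
Lemma size_tbl_le tbl :
  table_correct gadget (vertex 0 0) (vertex 1 0) 2 tbl ->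
  size tbl <= count (fun v => v != 0) (enc_table tbl).
Proof.
move=> tblP; rewrite /enc_table /= -[leqLHS]add0n leq_add //.
rewrite count_flatten -map_comp sumnE big_map -sum1_size.
rewrite big_seq [leqRHS]big_seq; apply: leq_sum => e eT /=.
have [F0|F_neq0] := eqVneq e.1 [::]; last first.
  by rewrite /enc_entry /=; case: (e.1) F_neq0.
by rewrite /enc_entry (table_dist tblP eT) F0.
Qed.

(** Distinct pairs of cuts need distinct entries, and each entry with low faults ends with a number
    above the threshold, which bounds all numbers of the input. *)
Lemma big_cells tbl :
  table_correct gadget (vertex 0 0) (vertex 1 0) 2 tbl ->
  n * n <= count (fun v => 2 * n * heavy + 1 < v) (enc_table tbl).
Proof.
move=> tblP.
apply: (@leq_trans (size [seq e <- tbl | low_faults e.1])).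
  rewrite -[n in n * _](size_iota 0) -[n in _ * n](size_iota 0).
  rewrite -(size_allpairs pair).
  rewrite -(size_map (fun e => (scan 0 m e.1, scan 1 m e.1))).
  apply: uniq_leq_size.
    by apply: allpairs_uniq; rewrite ?iota_uniq // => -[] ? ? [].
  move=> ij /allpairsP [[i j] [+ + ->]].
  rewrite !mem_iota !add0n /= => ii jj.
  have [e eT [okF <- <-]] := table_scan tblP ii jj.
  by apply/mapP; exists e => //; rewrite mem_filter okF.
rewrite size_filter -sum1_count /enc_table /= -[leqLHS]add0n leq_add //.
rewrite count_flatten -map_comp sumnE big_map big_mkcond.
rewrite big_seq [leqRHS]big_seq; apply: leq_sum => e eT /=.
case: ifP => // okF.
rewrite /enc_entry /= count_cat (table_dist tblP eT okF) /=.
have le0 := @scan_le 0 m e.1 (leqnn _); have le1 := @scan_le 1 m e.1 (leqnn _).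
(* As both cuts are at most [n - 1], the attachments alone sum to at least [(2n + 2) * heavy]. *)
suff -> : 2 * n * heavy + 1 < (cost (scan 0 m e.1) (scan 1 m e.1)).+1 by lia.
rewrite /cost /attach !mulnBl; move: le0 le1.
have : 0 < heavy by [].
by nia.
Qed.

Lemma wt_le i j : wt i j <= heavy.
Proof.
rewrite /wt /heavy /apsp_cells /apsp_input /= sumn_enc_matrix.
rewrite (bigD1 (inord i)) //= (bigD1 (inord j)) //=.
by move: (enc _) (\sum_(_ | _) _) (\sum_(_ | _) _) => a b c; lia.
Qed.

Lemma hcell_le x y : hcell x y <= 2 * n * heavy + 1.
Proof.
have le_big : heavy <= 2 * n * heavy by rewrite leq_pmull.
have big_gt0 : 0 < heavy by [].
rewrite /hcell; move: (_ %/ _) (_ %% _) (_ %/ _) (_ %% _) => p i q j.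
rewrite /cell /cell_of; case: eqP => _; last first.
  have : (2 * n - i) * heavy <= 2 * n * heavy.
    by rewrite leq_mul2r leq_subr orbT.
  by case: (1 < _); case: (_ == _); rewrite ?mul0n ?mul1n //; lia.
case: eqP => _; last by lia.
case: ifP => _; first by lia.
case: ifP => _; last by lia.
by apply: leq_trans (wt_le _ _) _; apply: leq_trans le_big _; exact: leq_addr.
Qed.

Lemma nth_frp_input k :
  nth 0 (frp_input frp_gadget) k =
  if k < 3 then nth 0 [:: N; 0; n] k
  else if k < 3 + N * N then hcell ((k - 3) %/ N) ((k - 3) %% N) else 0.
Proof.
have e0 : vertex 0 0 = 0 :> nat by rewrite vertexE.
have e1 : vertex 1 0 = n :> nat by rewrite vertexE // mul1n addn0.
rewrite /frp_input /= e0 e1.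
case: k => [|[|[|k]]]; [by [] | by [] | by [] |].
have -> : (k.+3 < 3 + N * N) = (k < N * N) by rewrite -[k.+3]/(3 + k) ltn_add2l.
have -> : k.+3 - 3 = k by lia.
rewrite -[LHS]/(nth 0 (enc_matrix hweight) k).
rewrite -[if k.+3 < 3 then _ else _]/(if k < N * N then _ else _).
case: ltnP => lt_k; last by rewrite nth_default // size_enc_matrix.
rewrite nth_enc_matrix // /hweight enc_dec !inordK //.
  by rewrite ltn_pmod.
by rewrite ltn_divLR.
Qed.

Lemma frp_input_le v : v \in frp_input frp_gadget -> v <= 2 * n * heavy + 1.
Proof.
move=> /(nthP 0) [k lt_k <-]; rewrite nth_frp_input.
have : 3 * n <= 2 * n * heavy by rewrite /heavy; nia.
case: ifP => _; last by case: ifP => // _ _; exact: hcell_le.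
by case: k {lt_k} => [|[|[|k]]] //=; try rewrite nth_nil; lia.
Qed.

End Gadget.

(** * The program *)

Arguments block : simpl never.

Lemma init_state_mk k x : init_state x = mk (nseq k 0) (fun=> 0) (nth 0 x).
Proof.
rewrite /init_state /mk; congr State; apply: funext => r.
by rewrite /regs nth_nseq !if_same.
Qed.

(* Register 0 holds 1, register 1 holds n, register 2 accumulates [heavy]. *)
Definition sum_body : cmd :=
  block [:: Bin Defs.Sub 3 3 0; Read 4 3; Bin Add 2 2 4].

Definition sum_prog : seq cmd :=
  [:: Const 0 1; Read 1 4; Bin Mul 3 1 1; Bin Add 3 3 0; Const 2 2;
      While 3 sum_body].

(* The cells of the input of 2FRP are written downwards, so that the cells of G
   are read before they are overwritten. *)
Definition build_body : cmd :=
  block [:: Bin Defs.Sub 3 3 0;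
    Bin Div 6 3 5; Bin Mul 7 6 5; Bin Defs.Sub 7 3 7;
    Bin Div 8 6 1; Bin Mul 9 8 1; Bin Defs.Sub 6 6 9;
    Bin Div 9 7 1; Bin Mul 10 9 1; Bin Defs.Sub 7 7 10;
    Bin Defs.Eq 10 8 9;
    If 10 (block
      [:: Const 11 2; Bin Defs.Eq 11 8 11;
        If 11 (block
          [:: Bin Defs.Eq 12 6 7;
            If 12 (block [:: Const 13 0]) (block
              [:: Bin Mul 13 6 1; Bin Add 13 13 7; Bin Add 13 13 0; Read 13 13;
                If 13 (block [::]) (block [:: Bin Mul 13 2 0])])])
          (block
          [:: Bin Add 12 6 0; Bin Defs.Eq 13 12 7; Bin Add 12 7 0;
            Bin Defs.Eq 12 12 6; Bin Add 13 13 12])])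
      (block
      [:: Bin Add 11 8 9; Bin Defs.Lt 11 0 11; Bin Defs.Eq 12 6 7; Bin Mul 11 11 12;
        Bin Add 12 1 1; Bin Defs.Sub 12 12 6; Bin Mul 12 12 2; Bin Add 12 12 0;
        Bin Mul 13 11 12]);
    Bin Add 12 3 4; Write 12 13].

(** The header [N], [s = 0], [t = n] overwrites [n] and the first cells of G, so it is written after
    the loop. *)
Definition build_prog : seq cmd :=
  [:: Const 4 3; Bin Mul 5 1 4; Bin Mul 3 5 5; While 3 build_body;
      Const 6 0; Write 6 5; Write 0 6; Const 6 2; Write 6 1].

Ltac run_const := apply: runs_const; [by [] | rewrite /=; lia | rewrite /=].
Ltac run_add := apply: runs_add; [by [] | rewrite /=; lia | rewrite /=].
Ltac run_sub :=
  apply: runs_sub; [by [] | rewrite /=; lia | rewrite /= ?(subSS, subn0)].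
Ltac run_mul := apply: runs_mul; [by [] | rewrite /=; lia | rewrite /=].
Ltac run_div := apply: runs_div; [by [] | rewrite /=; lia | rewrite /=].
Ltac run_lt := apply: runs_lt; [by [] | rewrite /=; lia | rewrite /=].
Ltac run_eq := apply: runs_eq; [by [] | rewrite /=; lia | rewrite /=].
Ltac run_read := apply: runs_read; [by [] | rewrite /=].
Ltac run_write := apply: runs_write; [by [] | rewrite /=].
Ltac run := first [run_const | run_add | run_sub | run_mul | run_div | run_lt
  | run_eq | run_read | run_write].

Lemma subn_divn a d : a - a %/ d * d = a %% d.
Proof. by rewrite {1}(divn_eq a d) addKn. Qed.

(** * Correctness of the construction of the gadget *)

Section Build.
Variables (w n M : nat) (h m0 tgt : nat -> nat) (wt : nat -> nat -> nat).
Hypotheses (n_gt0 : 0 < n) (lt_nM : n < M).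
Hypotheses (bound_n : 100 * (n * n) <= 2 ^ w) (bound_M : 100 * (n * M) <= 2 ^ w).

Let n_le : n <= n * n. Proof. by rewrite leq_pmull. Qed.
Let M_le : M <= n * M. Proof. by rewrite leq_pmull. Qed.

Lemma runs_sum (inp : seq nat) :
  size inp = (n * n).+1 -> nth 0 inp 0 = n -> M = (sumn inp).+2 ->
  runs w (block sum_prog) (mk (nseq 16 0) h (nth 0 inp)) (5 * (n * n) + 20)
    (fun st => exists v, st = mk
      [:: 1; n; M; 0; v; 0; 0; 0; 0; 0; 0; 0; 0; 0; 0; 0] h (nth 0 inp)).
Proof.
move=> size_inp inp0 ME.
(* The bound is reshaped so that each straight-line instruction consumes one successor and the loop
   one summand. *)
have -> : 5 * (n * n) + 20 = ((n * n).+1 * 5 + 1 + 9).+4.+1 by lia.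
rewrite /sum_prog; do 5!run; rewrite inp0.
pose Inv k st := k <= (n * n).+1 /\ exists v, st = mk
  [:: 1; n; 2 + sumn (drop k inp); k; v; 0; 0; 0; 0; 0; 0; 0; 0; 0; 0; 0]
  h (nth 0 inp).
have inv0 : Inv (n * n).+1 (mk [:: 1; n; 2; n * n + 1; 0;
    0; 0; 0; 0; 0; 0; 0; 0; 0; 0; 0] h (nth 0 inp)).
  by split=> //; exists 0; rewrite drop_oversize ?size_inp ?addn1.
have step k st : Inv k.+1 st -> reg st 3 != 0 /\ runs w sum_body st 3.+1 (Inv k).
  move=> [lt_k [v ->]]; split=> //; rewrite /sum_body.
  have sumE : sumn (drop k inp) = nth 0 inp k + sumn (drop k.+1 inp).
    by rewrite (drop_nth 0) ?size_inp.
  have le_sum : sumn (drop k inp) <= sumn inp.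
    by rewrite -[in leqRHS](cat_take_drop k inp) sumn_cat leq_addl.
  move: (sumn (drop k.+1 inp)) sumE => s sumE.
  do 3!run; apply: runs_nil; split; first by lia.
  by exists (nth 0 inp k); rewrite sumE addnA addnAC.
have stop st : Inv 0 st -> reg st 3 = 0 by move=> [_ [v ->]].
apply: runs_cons (runs_while step stop inv0) _ => st [_ [v ->]].
by apply: runs_nil; exists v; rewrite drop0 ME.
Qed.

Let N := 3 * n.
Let hc (k : nat) : nat :=
  cell_of n M wt (k %/ N %/ n) (k %/ N %% n) (k %% N %/ n) (k %% N %% n).

Hypothesis m0_wt : forall i j, i < n -> j < n -> m0 (1 + i * n + j) = wt i j.

(** The memory during the downward loop: old contents below [3 + k], finished cells from there
    on. *)
Let built (k a : nat) : nat := if a < 3 + k then m0 a else tgt a.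

Lemma runs_build_body k s6 s7 s8 s9 s10 s11 s12 s13 :
  k < N * N -> tgt (3 + k) = hc k ->
  runs w build_body
    (mk [:: 1; n; M; k.+1; 3; N; s6; s7; s8; s9; s10; s11; s12; s13; 0; 0] h
      (built k.+1))
    40
    (fun st => exists s, let: (s6, s7, s8, s9, s10, s11, s12, s13) := s in
      st = mk [:: 1; n; M; k; 3; N; s6; s7; s8; s9; s10; s11; s12; s13; 0; 0] h
        (built k)).
Proof.
move=> lt_k tgtk.
have N_gt0 : 0 < N by rewrite /N; lia.
have lt_x : k %/ N < N by rewrite ltn_divLR.
have lt_y : k %% N < N by rewrite ltn_pmod.
have NE : N = 3 * n by [].
have NN : N * N = 9 * (n * n) by rewrite NE mulnACA.
have xN : k %/ N * N <= k by exact: leq_trunc_div.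
have kE := divn_eq k N.
have upd_built v : v = tgt (3 + k) -> upd (built k.+1) (k + 3) v = built k.
  move=> ->; apply: funext => a; rewrite /upd /built addnC.
  case: eqP => [->|ne_a]; first by rewrite ltnn.
  by have -> : (a < 3 + k.+1) = (a < 3 + k) by lia.
rewrite /build_body; do 4!run; rewrite subn_divn.
rewrite /hc in tgtk.
move: (k %/ N) (k %% N) xN lt_x lt_y kE tgtk upd_built => x y.
move=> xN lt_x lt_y kE tgtk upd_built.
have lt_p : x %/ n < 3 by rewrite ltn_divLR.
have lt_q : y %/ n < 3 by rewrite ltn_divLR.
have lt_i : x %% n < n by rewrite ltn_pmod.
have lt_j : y %% n < n by rewrite ltn_pmod.
have pn : x %/ n * n <= x by exact: leq_trunc_div.
have qn : y %/ n * n <= y by exact: leq_trunc_div.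
have xE := divn_eq x n; have yE := divn_eq y n.
do 3!run; rewrite subn_divn; do 3!run; rewrite subn_divn.
move: (x %/ n) (x %% n) (y %/ n) (y %% n) lt_p lt_q lt_i lt_j pn qn xE yE tgtk.
move=> p i q j lt_p lt_q lt_i lt_j pn qn xE yE tgtk.
have lt_ij : i * n + j < n * n.
  have : i.+1 * n <= n * n by rewrite leq_mul2r lt_i orbT.
  by rewrite mulSn; lia.
have le_iM : (2 * n - i) * M <= 2 * (n * M).
  by rewrite mulnA leq_mul2r leq_subr orbT.
have write v v6 v7 v8 v9 v10 v11 v12 T : v = tgt (3 + k) ->
    runs w (block [:: Bin Add 12 3 4; Write 12 13])
      (mk [:: 1; n; M; k; 3; N; v6; v7; v8; v9; v10; v11; v12; v; 0; 0] h
        (built k.+1)) T.+3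
      (fun st => exists s, let: (s6, s7, s8, s9, s10, s11, s12, s13) := s in
        st = mk [:: 1; n; M; k; 3; N; s6; s7; s8; s9; s10; s11; s12; s13; 0; 0]
          h (built k)).
  move=> vE; do 2!run; rewrite upd_built //; apply: runs_nil.
  by exists (v6, v7, v8, v9, v10, v11, k + 3, v).
run; move: tgtk; rewrite /cell_of; have [eq_pq|ne_pq] := eqVneq p q => tgtk.
  subst q; apply: runs_if => //= _; do 2!run; move: tgtk.
  have [p2|ne_p2] := eqVneq p 2 => tgtk.
    subst p; apply: runs_if => //= _; run; move: tgtk.
    have [eq_ij|ne_ij] := eqVneq i j => tgtk.
      by apply: runs_if => //= _; run; apply: write; rewrite tgtk.
    apply: runs_if => //= _; do 4!run.
    (* The address read lies below the one about to be written, so the cell of G is still there. *)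
    have -> : built k.+1 (i * n + j + 1) = wt i j.
      by rewrite /built -m0_wt // addn1 ifT //; lia.
    apply: runs_if => //= [wt_neq0|wt0].
      by apply: write; rewrite tgtk wt_neq0.
    by run; apply: write; rewrite tgtk wt0 muln1.
  apply: runs_if => //= _; do 5!run; apply: write.
  by rewrite tgtk !addn1.
apply: runs_if => //= _; do 9!run; apply: write.
by rewrite tgtk addnn -mul2n.
Qed.

Lemma runs_build v :
  tgt 0 = N -> tgt 1 = 0 -> tgt 2 = n ->
  (forall k, k < N * N -> tgt (3 + k) = hc k) ->
  (forall a, 3 + N * N <= a -> m0 a = tgt a) ->
  runs w (block build_prog)
    (mk [:: 1; n; M; 0; v; 0; 0; 0; 0; 0; 0; 0; 0; 0; 0; 0] h m0)
    (400 * (n * n) + 20)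
    (fun st => exists2 s, size s = 13 & st = mk [:: 1, n, M & s] h tgt).
Proof.
move=> tgt0 tgt1 tgt2 tgtk tgt_out.
have NE : N = 3 * n by [].
have NN : N * N = 9 * (n * n) by rewrite NE mulnACA.
have -> : 400 * (n * n) + 20 = ((N * N * 41 + 1) + (31 * (n * n) + 16)).+3 by lia.
rewrite /build_prog; do 3!run; rewrite !(mulnC n 3) -NE.
pose Inv k st := k <= N * N /\ exists s,
  let: (s6, s7, s8, s9, s10, s11, s12, s13) := s in
  st = mk [:: 1; n; M; k; 3; N; s6; s7; s8; s9; s10; s11; s12; s13; 0; 0] h
    (built k).
have inv0 : Inv (N * N)
    (mk [:: 1; n; M; N * N; 3; N; 0; 0; 0; 0; 0; 0; 0; 0; 0; 0] h m0).
  split=> //; exists (0, 0, 0, 0, 0, 0, 0, 0); congr mk; apply: funext => a.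
  by rewrite /built; case: ltnP => // /tgt_out.
have step k st : Inv k.+1 st -> reg st 3 != 0 /\ runs w build_body st 40 (Inv k).
  move=> [lt_k [[[[[[[[s6 s7] s8] s9] s10] s11] s12] s13] ->]]; split=> //.
  apply: runs_weaken (runs_build_body _ _ _ _ _ _ _ _ lt_k (tgtk _ lt_k)) => //.
  by move=> st' st'E; split=> //; exact: ltnW.
have stop st : Inv 0 st -> reg st 3 = 0.
  by move=> [_ [[[[[[[[s6 s7] s8] s9] s10] s11] s12] s13] ->]].
apply: runs_cons (runs_while step stop inv0) _ => st.
move=> [_ [[[[[[[[s6 s7] s8] s9] s10] s11] s12] s13] ->]].
have -> : 31 * (n * n) + 16 = (31 * (n * n) + 9).+1.+4.+2 by lia.
do 5!run; apply: runs_nil.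
eexists; last first.
  congr mk; apply: funext => a.
  rewrite /upd /built.
  by case: a => [|[|[|a]]] //=; rewrite ?tgt0 ?tgt1 ?tgt2.
by [].
Qed.

End Build.

(** * Reading the table *)

Definition at_mem (mm : nat -> nat) (p : nat) (s : seq nat) : Prop :=
  forall i, i < size s -> mm (p + i) = nth 0 s i.

Lemma at_mem_cons mm p x s :
  at_mem mm p (x :: s) -> mm p = x /\ at_mem mm p.+1 s.
Proof.
move=> mmE; split=> [|i lt_i]; first by have := mmE 0 isT; rewrite addn0.
by rewrite addSnnS mmE.
Qed.

Lemma at_mem_cat mm p s1 s2 :
  at_mem mm p (s1 ++ s2) -> at_mem mm p s1 /\ at_mem mm (p + size s1) s2.
Proof.
move=> mmE; split=> i lt_i.
  by rewrite mmE ?nth_cat ?lt_i // size_cat ltn_addr.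
by rewrite -addnA mmE ?nth_cat ?size_cat ?ltn_add2l // ltnNge leq_addr addKn.
Qed.

(* Registers 8 and 9 hold the cuts of the a-path and of the b-path. *)
Definition half (a b : nat) : seq cmd :=
  [:: Bin Add 13 a 0; Bin Defs.Eq 13 13 b;
    Bin Defs.Lt 14 a 8; Bin Mul 14 14 13;
    If 14 (block [:: Bin Mul 8 a 0]) (block [::]);
    Bin Add 14 1 9; Bin Defs.Lt 14 a 14; Bin Mul 14 14 13; Bin Defs.Lt 15 a 1;
    Bin Defs.Sub 15 0 15; Bin Mul 14 14 15;
    If 14 (block [:: Bin Defs.Sub 9 a 1]) (block [::])].

Definition fault_body : cmd :=
  block ([:: Bin Defs.Sub 7 7 0; Read 11 6; Bin Add 6 6 0; Read 12 6; Bin Add 6 6 0;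
    Bin Add 13 1 1; Bin Defs.Lt 14 11 13; Bin Mul 10 10 14; Bin Defs.Lt 14 12 13;
    Bin Mul 10 10 14] ++ half 11 12 ++ half 12 11).

Definition entry_body : cmd :=
  block [:: Read 7 6; Bin Add 6 6 0; Bin Defs.Sub 8 1 0; Bin Defs.Sub 9 1 0;
    Const 10 1; While 7 fault_body; Read 11 6; Bin Add 6 6 0;
    If 10 (block [:: Bin Add 12 1 1; Bin Add 12 12 12; Bin Defs.Sub 12 12 8;
        Bin Defs.Sub 12 12 9; Bin Mul 12 12 2; Bin Defs.Sub 11 11 12; Bin Defs.Lt 12 11 2;
        Bin Mul 11 11 12; Bin Mul 12 8 1; Bin Add 12 12 9; Bin Add 12 12 5;
        Write 12 11])
      (block [::]);
    Bin Defs.Sub 3 3 0].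

(* The distances are stored from the address 2^w - n^2 (in register 5) on, out of
   the way of the table, which is still being read. *)
Definition parse_prog : seq cmd :=
  [:: Bin Mul 4 1 1; Const 5 0; Bin Defs.Sub 5 5 4; Const 6 0; Read 3 6; Const 6 1;
    While 3 entry_body].

Definition copy_body : cmd :=
  block [:: Bin Defs.Sub 3 3 0; Bin Add 6 5 3; Read 7 6; Write 3 7].

Definition copy_prog : seq cmd := [:: Bin Mul 3 1 1; While 3 copy_body].

Section Parse.
Variables (w m M : nat) (h : nat -> nat).
Local Notation n := m.+1.
Local Notation N := (3 * m).+3.
Hypothesis lt_nM : n < M.
Hypotheses (bound_n : 100 * (n * n) <= 2 ^ w) (bound_M : 100 * (n * M) <= 2 ^ w).

Let n_le : n <= n * n. Proof. by rewrite leq_pmull. Qed.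
Let M_le : M <= n * M. Proof. by rewrite leq_pmull. Qed.

Lemma cut_step_le p r x y : cut_step m p r x y <= r.
Proof. by rewrite /cut_step; case: ifP; lia. Qed.

(** The boolean [b] swaps the two endpoints, so that one statement serves both orientations of a
    fault. *)
Lemma runs_half b c nn Z ptr fc I J o x y s13 s14 s15 mm cs T Q :
  x < N -> y < N -> I <= m -> J <= m ->
  (forall t13 t14 t15, runs w (block cs)
    (mk [:: 1; n; M; c; nn; Z; ptr; fc;
      cut_step m 0 I (if b then y else x) (if b then x else y);
      cut_step m 1 J (if b then y else x) (if b then x else y);
      o; x; y; t13; t14; t15] h mm) T Q) ->
  runs w (block (half (if b then 12 else 11) (if b then 11 else 12) ++ cs))
    (mk [:: 1; n; M; c; nn; Z; ptr; fc; I; J; o; x; y; s13; s14; s15] h mm)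
    (T + 16) Q.
Proof.
move=> lt_x lt_y le_I le_J ok.
have {ok} ok I' J' t13 t14 t15 T' : T <= T' ->
    I' = cut_step m 0 I (if b then y else x) (if b then x else y) ->
    J' = cut_step m 1 J (if b then y else x) (if b then x else y) ->
    runs w (block cs) (mk [:: 1; n; M; c; nn; Z; ptr; fc; I'; J'; o; x; y;
      t13; t14; t15] h mm) T' Q.
  by move=> le_T -> ->; exact: runs_weaken le_T _ (ok t13 t14 t15).
have -> : T + 16 = T.+4.+4.+4.+4 by lia.
rewrite /half.
case: b ok => ok /=;
  do 4!run; apply: runs_if => //= cI; [run | | run | ];
  do 6!run; apply: runs_if => //= cJ; try run;
  (apply: ok; rewrite /cut_step; [lia | case: ifP; lia | case: ifP; lia]).
Qed.

Definition enc_faults (F : seq ('I_N * 'I_N)) : seq nat :=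
  flatten [seq [:: nat_of_ord d.1; nat_of_ord d.2] | d <- F].

Lemma runs_faults F c nn Z p s11 s12 s13 s14 s15 mm :
  at_mem mm p (enc_faults F) -> p + 2 * size F < 2 ^ w ->
  runs w (While 7 fault_body)
    (mk [:: 1; n; M; c; nn; Z; p; size F; m; m; 1; s11; s12; s13; s14; s15] h mm)
    (size F * 51 + 1)
    (fun st => exists s, let: (s11, s12, s13, s14, s15) := s in st = mk
      [:: 1; n; M; c; nn; Z; p + 2 * size F; 0; scan 0 m F; scan 1 m F;
        nat_of_bool (low_faults F); s11; s12; s13; s14; s15] h mm).
Proof.
move=> mmF lt_p.
(* The invariant looks ahead: scanning the remaining faults from the current registers gives the
   final cuts. *)
pose Inv k st := exists rest I J p' (b : bool),
  [/\ size rest = k,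
     (I <= m) && (J <= m),
     [/\ scan 0 I rest = scan 0 m F, scan 1 J rest = scan 1 m F &
         b && low_faults rest = low_faults F],
     p' + 2 * size rest = p + 2 * size F /\ at_mem mm p' (enc_faults rest)
   & exists s, let: (s11, s12, s13, s14, s15) := s in st = mk
      [:: 1; n; M; c; nn; Z; p'; k; I; J; nat_of_bool b; s11; s12; s13; s14; s15] h mm].
have inv0 : Inv (size F) (mk
    [:: 1; n; M; c; nn; Z; p; size F; m; m; 1; s11; s12; s13; s14; s15] h mm).
  exists F, m, m, p, true; split; rewrite ?leqnn //.
  by exists (s11, s12, s13, s14, s15).
have step k st : Inv k.+1 st -> reg st 7 != 0 /\ runs w fault_body st 50 (Inv k).
  move=> [[|d rest] [I [J [p' [b [//= [size_rest] /andP [le_I le_J]]]]]]].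
  move=> [scanI scanJ okE] [pE].
  move=> /at_mem_cons [mm1 /at_mem_cons [mm2 mm_rest]].
  move=> [[[[[v11 v12] v13] v14] v15] ->]; split=> //.
  have le_step q r x y : r <= m -> cut_step m q r x y <= m.
    exact: leq_trans (cut_step_le _ _ _ _).
  have lt_x := ltn_ord d.1; have lt_y := ltn_ord d.2.
  rewrite /fault_body; run; do 2!run; rewrite mm1 addn1; do 2!run.
  rewrite mm2 addn1; do 5!run.
  have -> : 40 = 8 + 16 + 16 by [].
  apply: (@runs_half false) => // t13 t14 t15.
  rewrite -[half 12 11]cats0.
  apply: (@runs_half true) => //; try exact: le_step.
  move=> u13 u14 u15; apply: runs_nil.
  exists rest, (cut_step m 0 (cut_step m 0 I d.1 d.2) d.2 d.1).
  exists (cut_step m 1 (cut_step m 1 J d.1 d.2) d.2 d.1), p'.+2.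
  exists (b && ((d.1 < 2 * n) && (d.2 < 2 * n))); split; first by [].
  - by apply/andP; split; apply: (le_step); apply: (le_step).
  - by rewrite -andbA.
  - by split; [lia | ].
  - exists (nat_of_ord d.1, nat_of_ord d.2, u13, u14, u15).
    by rewrite !mulnb addnn -mul2n -andbA.
have stop st : Inv 0 st -> reg st 7 = 0.
  move=> [rest [I [J [p' [b [_ _ _ _]]]]]].
  by move=> [[[[[? ?] ?] ?] ?] ->].
apply: runs_weaken (runs_while step stop inv0) => // st.
move=> [rest [I [J [p' [b [/eqP/nilP -> _ [/= <- <- <-] [<- _]]]]]]].
by rewrite andbT addn0.
Qed.

Lemma runs_entry (G : wgraph n) (e : seq ('I_N * 'I_N) * option nat) k Z p
    s7 s8 s9 s10 s11 s12 s13 s14 s15 mm :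
  M = heavy G -> Z + n * n = 2 ^ w -> k.+1 < 2 ^ w ->
  at_mem mm p (enc_entry e) -> p + size (enc_entry e) <= Z ->
  size e.1 <= 2 ->
  (low_faults e.1 -> e.2 = Some (cost G (scan 0 m e.1) (scan 1 m e.1))) ->
  runs w entry_body
    (mk [:: 1; n; M; k.+1; n * n; Z; p; s7; s8; s9; s10; s11; s12; s13; s14; s15]
      h mm) 140
    (fun st => exists2 s, size s = 9 & st = mk
      [:: 1, n, M, k, n * n, Z, p + size (enc_entry e) & s] h
      (if low_faults e.1 then
        upd mm (Z + (scan 0 m e.1 * n + scan 1 m e.1))
          (enc (gdist G (inord (scan 0 m e.1)) (inord (scan 1 m e.1))))
      else mm)).
Proof.
move=> ME ZE lt_k mmE le_p le2 distE.
have sizeE : size (enc_entry e) = (2 * size e.1).+2.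
  rewrite /enc_entry /= size_cat /= addn1; congr _.+2.
  by elim: (e.1) => //= d F IH; rewrite IH; lia.
rewrite sizeE in le_p *.
move: mmE; rewrite /enc_entry -/(enc_faults e.1).
move=> /at_mem_cons [mm0 /at_mem_cat [mmF]].
have -> : size (enc_faults e.1) = 2 * size e.1.
  by move: sizeE; rewrite /enc_entry /= size_cat -/(enc_faults e.1) /=; lia.
move=> /at_mem_cons [mmv _].
rewrite /entry_body; run; rewrite mm0; do 4!run; rewrite addn1.
have -> : 135 = (2 * 51 + 1) + 32 by [].
apply: (@runs_cons w _ _ _ (2 * 51 + 1) 32 (fun st => exists s,
    let: (s11, s12, s13, s14, s15) := s in st = mk
      [:: 1; n; M; k.+1; n * n; Z; p.+1 + 2 * size e.1; 0; scan 0 m e.1;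
        scan 1 m e.1; nat_of_bool (low_faults e.1); s11; s12; s13; s14; s15] h mm)).
  apply: runs_weaken (runs_faults _ _ _ _ _ _ _ _ mmF _) => //; last by lia.
  by rewrite leq_add2r leq_mul2r le2 orbT.
move=> st [[[[[v11 v12] v13] v14] v15] ->]; run; rewrite mmv; run.
have pE : p.+1 + 2 * size e.1 + 1 = p + (2 * size e.1).+2 by lia.
rewrite pE; have [okF|nok] := boolP (low_faults e.1); last first.
  apply: runs_if => //= _; run; apply: runs_nil.
  by eexists; last reflexivity.
apply: runs_if => //= _.
have le_I := @scan_le m 0 m e.1 (leqnn m); have le_J := @scan_le m 1 m e.1 (leqnn m).
rewrite distE //; move: (scan 0 m e.1) (scan 1 m e.1) le_I le_J => I J le_I le_J.
rewrite /enc -/(enc _) /cost.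
(* Both attachments come from one product, [4n - I - J] being [2n - I] plus [2n - J]. *)
have attachE : (n + n + (n + n) - I - J) * M = attach G I + attach G J.
  by rewrite /attach -ME -mulnDl; congr (_ * _); lia.
have attach_le : (n + n + (n + n) - I - J) * M <= 4 * (n * M).
  by rewrite mulnA leq_mul2r; lia.
have lt_td := trunc_dist_lt G I J; rewrite -ME in lt_td.
have IJ : I * n + J < n * n.
  have : I.+1 * n <= n * n by rewrite leq_mul2r ltnS le_I orbT.
  by rewrite mulSn; lia.
do 5!run; rewrite attachE; run.
have -> : (attach G I + attach G J + trunc_dist G I J).+1 - (attach G I + attach G J) =
  (trunc_dist G I J).+1 by lia.
run; run; have -> : (trunc_dist G I J).+1 * ((trunc_dist G I J).+1 < M) =
  enc (gdist G (inord I) (inord J)) by rewrite ME mulnC enc_gdist.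
do 5!run; apply: runs_nil; rewrite (addnC _ Z).
by eexists; last reflexivity.
Qed.

Section Table.
Variables (G : wgraph n) (tbl : table N) (mm : nat -> nat) (Z : nat).
Hypothesis tblP : table_correct (gadget G) (vertex m 0 0) (vertex m 1 0) 2 tbl.
Hypotheses (ME : M = heavy G) (mm_tbl : at_mem mm 0 (enc_table tbl)).
Hypotheses (ZE : Z + n * n = 2 ^ w) (tbl_le : size (enc_table tbl) <= Z).

Let out : seq nat := enc_matrix (gdist G).

Let at_out I J : I <= m -> J <= m ->
  enc (gdist G (inord I) (inord J)) = nth 0 out (I * n + J).
Proof.
move=> le_I le_J; have IJ : I * n + J < n * n.
  have : I.+1 * n <= n * n by rewrite leq_mul2r ltnS le_I orbT.
  by rewrite mulSn; lia.
rewrite nth_enc_matrix // divnMDl // divn_small // addn0.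
by rewrite modnMDl modn_small.
Qed.

Lemma runs_parse s :
  size s = 13 ->
  runs w (block parse_prog) (mk [:: 1, n, M & s] h mm) (size tbl * 141 + 8)
    (fun st => exists s' mm', [/\ size s' = 10,
      st = mk [:: 1, n, M, 0, n * n, Z & s'] h mm' &
      forall a, a < n * n -> mm' (Z + a) = nth 0 out a]).
Proof.
move=> size_s; have size_tbl : size tbl < 2 ^ w.
  have := leq_trans (size_tbl_le tblP) (count_size _ _).
  by move=> /leq_trans /(_ tbl_le); lia.
have [mm0 mm_rest] := at_mem_cons mm_tbl.
case: s size_s => [|s3 [|s4 [|s5 [|s6 [|s7 [|s8 [|s9 [|s10 [|s11 [|s12 [|s13
  [|s14 [|s15 [|]]]]]]]]]]]]]] // _.
have -> : size tbl * 141 + 8 = (size tbl * 141 + 1 + 1).+4.+2 by lia.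
rewrite /parse_prog; do 2!run.
(* Here [0 - n^2] wraps around modulo [2 ^ w], so the rule for subtraction without underflow does
   not apply. *)
apply: (runs_bin (v := Z)) => //=.
  by rewrite /binop_val add0n modn_small; lia.
do 3!run; rewrite mm0.
pose Inv k st := exists done rest mm' p s,
  [/\ tbl = done ++ rest, size rest = k /\ size s = 9,
     at_mem mm' p (flatten (map (@enc_entry N) rest)) /\
     p + size (flatten (map (@enc_entry N) rest)) <= Z,
     forall e, e \in done -> low_faults e.1 ->
       let a := scan 0 m e.1 * n + scan 1 m e.1 in mm' (Z + a) = nth 0 out a
   & st = mk [:: 1, n, M, k, n * n, Z, p & s] h mm'].
have inv0 : Inv (size tbl) (mk [:: 1; n; M; size tbl; n * n; Z; 1;
    s7; s8; s9; s10; s11; s12; s13; s14; s15] h mm).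
  by exists [::], tbl, mm, 1, [:: s7; s8; s9; s10; s11; s12; s13; s14; s15]; split.
have step k st : Inv k.+1 st -> reg st 3 != 0 /\ runs w entry_body st 140 (Inv k).
  move=> [done [rest [mm' [p [s [tblE [size_rest size_s] [mmE le_p] outE ->]]]]]].
  split=> //; case: rest => [//|e rest] in tblE size_rest mmE le_p *.
  have eT : e \in tbl by rewrite tblE mem_cat mem_head orbT.
  case: s size_s => [|t7 [|t8 [|t9 [|t10 [|t11 [|t12 [|t13 [|t14 [|t15 [|]]]]]]]]]] // _.
  move: mmE le_p; rewrite -[flatten _]/(enc_entry e ++ flatten (map (@enc_entry N) rest)).
  move=> /at_mem_cat [mm_e mm_r]; rewrite size_cat => le_p.
  have lt_k : k.+1 < 2 ^ w.
    by rewrite -size_rest; move: size_tbl; rewrite tblE size_cat; lia.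
  have [le2 _] := tblP.1 _ eT.
  have le_e : p + size (enc_entry e) <= Z by lia.
  apply: runs_weaken (runs_entry _ _ _ _ _ _ _ _ _ ME ZE lt_k mm_e le_e le2
    (table_dist tblP eT)) => // st' [s size_s ->].
  have le_I := @scan_le m 0 m e.1 (leqnn m).
  have le_J := @scan_le m 1 m e.1 (leqnn m).
  exists (rcons done e), rest; do 3!eexists; split; last reflexivity.
  - by rewrite cat_rcons.
  - by split; [case: size_rest | exact: size_s].
  - split; last by rewrite -addnA.
    move=> i lt_i; case: ifP => _; last exact: mm_r.
    by rewrite /upd ifN ?mm_r //; lia.
  - move=> e'; rewrite mem_rcons inE => /predU1P [->|e'_in] ok' /=.
      by rewrite ok' /upd eqxx at_out.
    case: ifP => _; last exact: outE.
    (* A later entry with the same cuts rewrites the same value. *)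
    rewrite /upd eqn_add2l; case: eqP => [->|_]; first by rewrite at_out.
    exact: outE.
have stop st : Inv 0 st -> reg st 3 = 0.
  by move=> [? [? [? [? [? [_ _ _ _ ->]]]]]].
apply: runs_cons (runs_while step stop inv0) _ => st.
move=> [done [rest [mm' [p [s [tblE [/eqP/nilP rest0 size_s] _ outE ->]]]]]].
apply: runs_nil; exists (p :: s), mm'; split=> //=; first by rewrite size_s.
move=> a lt_a.
have le_I : a %/ n <= m by rewrite -ltnS ltn_divLR.
have le_J : a %% n <= m by rewrite -ltnS ltn_pmod.
have [e eT [okF eI eJ]] := table_scan tblP le_I le_J.
have e_done : e \in done by move: eT; rewrite tblE rest0 cats0.
by have := outE e e_done okF; rewrite /= eI eJ -divn_eq.
Qed.

Lemma runs_copy s mm' :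
  size s = 10 ->
  (forall a, a < n * n -> mm' (Z + a) = nth 0 out a) ->
  runs w (block copy_prog) (mk [:: 1, n, M, 0, n * n, Z & s] h mm')
    (n * n * 6 + 3)
    (fun st => forall a, a < n * n -> Defs.mem st a = nth 0 out a).
Proof.
case: s => [|s6 [|s7 [|s8 [|s9 [|s10 [|s11 [|s12 [|s13 [|s14 [|s15 [|]]]]]]]]]]] //.
move=> _ mmE; have -> : n * n * 6 + 3 = (n * n * 6 + 1 + 1).+1 by lia.
rewrite /copy_prog; run.
pose Inv k st := k <= n * n /\ exists v6 v7 mm2,
  [/\ forall a, a < n * n -> mm2 (Z + a) = nth 0 out a,
     forall a, k <= a < n * n -> mm2 a = nth 0 out a
   & st = mk [:: 1; n; M; k; n * n; Z; v6; v7; s8; s9; s10; s11; s12; s13; s14;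
       s15] h mm2].
have inv0 : Inv (n * n) (mk [:: 1; n; M; n * n; n * n; Z; s6; s7; s8; s9; s10;
    s11; s12; s13; s14; s15] h mm').
  by split=> //; exists s6, s7, mm'; split=> // a; lia.
have step k st : Inv k.+1 st -> reg st 3 != 0 /\ runs w copy_body st 5 (Inv k).
  move=> [lt_k [v6 [v7 [mm2 [mmZ mmk ->]]]]]; split=> //.
  rewrite /copy_body; do 4!run; apply: runs_nil; split; first exact: ltnW.
  exists (Z + k), (mm2 (Z + k)); eexists; split; last reflexivity.
    by move=> a lt_a; rewrite /upd ifN ?mmZ //; lia.
  move=> a /andP [le_a lt_a]; rewrite /upd; case: eqP => [->|ne_a].
    exact: mmZ.
  by apply: mmk; lia.
have stop st : Inv 0 st -> reg st 3 = 0.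
  by move=> [_ [? [? [? [_ _ ->]]]]].
apply: runs_cons (runs_while step stop inv0) _ => st [_ [? [? [mm2 [_ mm2E ->]]]]].
by apply: runs_nil => a lt_a; exact: mm2E.
Qed.

End Table.
End Parse.

(** * Running time and word size of the reduction *)

Lemma sumn_le_max (s : seq nat) : sumn s <= size s * \max_(a <- s) a.
Proof.
elim: s => [|x s IH] //=; rewrite big_cons mulSn leq_add ?leq_maxl //.
by apply: leq_trans IH _; rewrite leq_mul2l leq_maxr orbT.
Qed.

Definition apsp_prog (c : cmd) : cmd :=
  Seq (block sum_prog) (Seq (block build_prog) (Seq (shift 16 c)
    (Seq (block parse_prog) (block copy_prog)))).

Section Reduction.
Variables (w m : nat) (G : wgraph m.+1) (c : cmd).
Local Notation n := m.+1.
Local Notation M := (heavy G).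
Local Notation H := (frp_gadget G).
Variables (t : nat) (st : state) (tbl : table (3 * m).+3).
Hypothesis ex_c : exec w c (init_state (frp_input H)) t st.
Hypothesis tblP : table_correct (gadget G) (vertex m 0 0) (vertex m 1 0) 2 tbl.
Hypothesis st_tbl :
  forall i, i < size (enc_table tbl) -> Defs.mem st i = nth 0 (enc_table tbl) i.

Lemma frp_time_ge : n * n <= t.
Proof.
apply: leq_trans (big_cells tblP) _.
(* No cell initially exceeds the threshold, so no input cell has to be exempted. *)
rewrite -[t]add0n -[0]/(size (Nil nat)); apply: exec_count ex_c _ st_tbl => a _.
rewrite -leqNgt /=; case: (ltnP a (size (frp_input H))) => [lt_a|ge_a].
  by apply: frp_input_le; exact: mem_nth.
by rewrite nth_default.
Qed.

(** Nonzero cells are counted here, so all [3 + 9 n^2] input cells are exempted. *)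
Lemma size_tbl_time : size tbl <= 3 + 9 * (n * n) + t.
Proof.
apply: leq_trans (size_tbl_le tblP) _.
have -> : 3 + 9 * (n * n) = size (iota 0 (size (frp_input H))).
  by rewrite size_iota /= size_enc_matrix; lia.
apply: exec_count ex_c _ st_tbl => a; rewrite mem_iota /= add0n -leqNgt => ge_a.
by rewrite nth_default.
Qed.

Lemma size_enc_table : size (enc_table tbl) <= 1 + 6 * size tbl.
Proof.
rewrite /enc_table /= add1n ltnS size_flatten /shape -map_comp sumnE big_map.
rewrite -sum1_size big_distrr /= big_seq [leqRHS]big_seq.
apply: leq_sum => e eT; have [le2 _] := tblP.1 _ eT.
rewrite /enc_entry /= size_cat /= size_flatten /shape -map_comp.
have -> : sumn [seq size [:: nat_of_ord d.1; nat_of_ord d.2] | d <- e.1] = 2 * size e.1.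
  by elim: (e.1) => //= d F ->; lia.
by lia.
Qed.

Hypotheses (bound_n : 100 * (n * n) <= 2 ^ w) (bound_M : 100 * (n * M) <= 2 ^ w).
Hypothesis bound_tbl : size (enc_table tbl) + n * n <= 2 ^ w.

Lemma runs_apsp :
  runs w (apsp_prog c) (init_state (apsp_cells G)) (5000 * t)
    (fun st' => forall a, a < n * n ->
      Defs.mem st' a = nth 0 (enc_matrix (gdist G)) a).
Proof.
have NE : (3 * m).+3 = 3 * n by lia.
have lt_nM : n < M by rewrite /heavy /=; lia.
have n_gt0 : 0 < n by [].
rewrite (init_state_mk 16).
have t_gt0 := exec_pos ex_c.
apply: (@runs_weaken _ _ _ ((5 * (n * n) + 20) + ((400 * (n * n) + 20) +
  (t + ((size tbl * 141 + 8) + (n * n * 6 + 3)))))) => [|st' q|].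
(* With [n^2 <= t], [1 <= t] and the bound on the table, every summand is a multiple of [t]; 5000 is
   a generous total. *)
- by have := frp_time_ge; have := size_tbl_time; lia.
- exact: q.
apply: runs_seq.
  by apply: (runs_sum _ n_gt0 lt_nM bound_n bound_M); rewrite //= size_enc_matrix.
move=> st1 [v ->]; apply: runs_seq.
  apply: (runs_build (tgt := nth 0 (frp_input H)) (wt := wt G) _
    n_gt0 lt_nM bound_n bound_M).
  - move=> i j lt_i lt_j.
    have IJ : i * n + j < n * n.
      have : i.+1 * n <= n * n by rewrite leq_mul2r lt_i orbT.
      by rewrite mulSn; lia.
    rewrite -addnA /= nth_enc_matrix // divnMDl // divn_small // addn0.
    by rewrite modnMDl modn_small.
  - by rewrite nth_frp_input.
  - by rewrite nth_frp_input.
  - by rewrite nth_frp_input.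
  - move=> k lt_k; rewrite nth_frp_input NE ltn_add2l lt_k.
    by rewrite -[3 + k < 3]/false addKn.
  - move=> a ge_a; rewrite nth_frp_input NE [a < 3 + _]ltnNge ge_a.
    have -> : a < 3 = false by lia.
    by rewrite nth_default // /= size_enc_matrix; lia.
move=> st2 [s size_s ->].
have ex_sh := exec_shift [:: 1, n, M & s] ex_c.
have size16 : size [:: 1, n, M & s] = 16 by rewrite /= size_s.
rewrite size16 in ex_sh.
pose st3 := mk [:: 1, n, M & s] (reg st) (Defs.mem st).
apply: (@runs_seq w _ _ _ t _ (eq st3)); first by exists t, st3.
move=> _ <-; rewrite {}/st3.
pose Z := 2 ^ w - n * n.
have ZE : Z + n * n = 2 ^ w by rewrite subnK //; lia.
have tbl_le : size (enc_table tbl) <= Z by lia.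
apply: runs_seq.
  by apply: (runs_parse (Z := Z) _ lt_nM bound_n bound_M tblP) => //=; rewrite size_s.
move=> st4 [s' [mm' [size_s' -> mmE]]].
exact: (runs_copy _ lt_nM bound_n bound_M _ ZE tbl_le).
Qed.

End Reduction.

(** [X] is the base of the word size condition for APSP. In the exponent, [5 * k] covers the
    condition of the call, whose own base is at most [X ^ 5]; [c0] absorbs the constant of the
    running time, as [c0 < X ^ c0]; 8 covers the polynomial factors. *)
Lemma power_bounds (X k c0 n M : nat) :
  0 < n -> n * n + 3 <= X -> M <= X * X ->
  let B := X ^ (5 * k + c0 + 8) in
  [/\ (3 + 9 * (n * n) + (2 * n * M + 1) + 2) ^ k <= B,
      100 * (n * n) <= B, 100 * (n * M) <= B
    & n * n + (1 + 6 * (3 + 9 * (n * n) + c0 * (3 * n) ^ 3)) <= B].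
Proof.
move=> n_gt0 le_nX le_MX B.
have X_gt0 : 0 < X by lia.
have le_n : n <= n * n by rewrite leq_pmull.
have X2 : 4 * X <= X * X by rewrite leq_mul2r; lia.
have X3 : 4 * (X * X) <= X * X * X by rewrite -mulnA leq_mul2r; lia.
have X4 : 4 * (X * X * X) <= X ^ 4.
  have -> : X ^ 4 = X * (X * X * X) by rewrite !expnS expn0 muln1 !mulnA.
  by rewrite leq_mul2r; lia.
have X5 : 4 * X ^ 4 <= X ^ 5 by rewrite (expnS X 4) leq_mul2r; lia.
have X6 : 4 * X ^ 5 <= X ^ 6 by rewrite (expnS X 5) leq_mul2r; lia.
have X7 : 4 * X ^ 6 <= X ^ 7 by rewrite (expnS X 6) leq_mul2r; lia.
have nM : n * M <= X * X * X.
  by rewrite -mulnA leq_mul //; lia.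
have n3 : n * n * n <= X * X by rewrite leq_mul //; lia.
have XB e : e <= 5 * k + c0 + 8 -> X ^ e <= B by move=> ?; rewrite leq_pexp2l.
split.
- apply: (@leq_trans ((X ^ 5) ^ k)); last by rewrite -expnM XB //; lia.
  by case: (posnP k) => [->//|k_gt0]; rewrite leq_exp2r //; lia.
- by have := XB 7; lia.
- by have := XB 7; lia.
have c0X : c0.+1 <= X ^ c0.
  apply: (@leq_trans (2 ^ c0)); first exact: ltn_expl.
  by case: (posnP c0) => [->//|c0_gt0]; rewrite leq_exp2r //; lia.
apply: (@leq_trans (X ^ c0 * X ^ 8)); last by rewrite -expnD XB //; lia.
apply: (@leq_trans (c0.+1 * X ^ 8)); last by rewrite leq_mul2r c0X orbT.
have X8 : 4 * X ^ 7 <= X ^ 8 by rewrite (expnS X 7) leq_mul2r; lia.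
have -> : (3 * n) ^ 3 = 27 * (n * n * n) by rewrite !expnS expn0; lia.
have : c0 * (n * n * n) <= c0 * (X * X) by rewrite leq_mul2l n3 orbT.
have : c0 * (4 * 4 * 4 * 4 * (X * X)) <= c0 * X ^ 8 by rewrite leq_mul2l; lia.
by rewrite mulSn; lia.
Qed.

Lemma input_bounds m (G : wgraph m.+1) :
  let X := size (apsp_cells G) + \max_(a <- apsp_cells G) a + 2 in
  m.+1 * m.+1 + 3 <= X /\ heavy G <= X * X.
Proof.
have := sumn_le_max (apsp_cells G); rewrite /heavy.
have -> : size (apsp_cells G) = (m.+1 * m.+1).+1 by rewrite /= size_enc_matrix.
move: (sumn _) (\max_(_ <- _) _) => s x le_s; split; first by lia.
nia.
Qed.

Lemma gadget_bounds m (G : wgraph m.+1) :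
  size (frp_input (frp_gadget G)) + \max_(a <- frp_input (frp_gadget G)) a + 2
    <= 3 + 9 * (m.+1 * m.+1) + (2 * m.+1 * heavy G + 1) + 2.
Proof.
rewrite leq_add2r leq_add //.
  by rewrite /= size_enc_matrix; lia.
by apply/bigmax_leqP_seq => a aH _; exact: frp_input_le.
Qed.

Local Open Scope ring_scope.

Theorem theorem49 (R : realType) (eps : R) (eps_gt0 : 0 < eps) :
  solvable_in_O (frp 2) (fun n : nat => n%:R `^ (3 - eps)) ->
  solvable_in_O apsp (fun n : nat => n%:R `^ (3 - eps)).
Proof.
move=> [c [k [C [k_gt0 frpP]]]].
pose c0 := Num.bound `|C|.
have leC : C <= c0%:R.
  by apply: le_trans (ler_norm C) (ltW _); apply: archi_boundP.
(* The factor [3 ^ (3 - eps)] accounts for the [3n] vertices of the gadget. *)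
exists (apsp_prog c), (5 * k + c0 + 8)%N, (5000%:R * C * 3%:R `^ (3 - eps)).
split=> [|[[|m] G] w //= _ le_w]; first by rewrite addn_gt0 orbT.
have [le_nX le_MX] := input_bounds G.
have [] := @power_bounds _ k c0 m.+1 _ isT le_nX le_MX.
move=> /leq_trans /(_ le_w) bk /leq_trans /(_ le_w) bn /leq_trans /(_ le_w) bM.
move=> /leq_trans /(_ le_w) bt.
have [|t [st [out [ex_c le_t [tbl [tblP ->]] _ st_tbl]]]] :=
    frpP (frp_gadget G) w isT.
  by apply: leq_trans bk; rewrite leq_exp2r //; exact: gadget_bounds.
have NE : (3 * m).+3 = (3 * m.+1)%N by rewrite mulnS.
rewrite /= NE in le_t.
(* Dropping [eps] from the exponent gives a bound in natural numbers, from which the table is shown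
   to fit into memory. *)
have t_le : (t <= c0 * (3 * m.+1) ^ 3)%N.
  rewrite -(ler_nat R) natrM natrX; apply: le_trans le_t _.
  apply: le_trans (ler_wpM2r (powR_ge0 _ _) leC) _.
  rewrite ler_wpM2l // -powR_mulrn // ler_powR ?ler1n //.
  by rewrite lerBlDr lerDl ltW.
have size_le := size_enc_table tblP.
have tbl_le := size_tbl_time ex_c tblP st_tbl.
have [|t' [st' [ex le_t' st'E]]] := runs_apsp ex_c tblP st_tbl bn bM; first by lia.
exists t', st', (enc_matrix (gdist G)); split=> //.
- apply: (@le_trans _ _ (5000 * t)%:R); first by rewrite ler_nat.
  rewrite natrM -!mulrA ler_wpM2l //.
  by move: le_t; rewrite natrM powRM ?ler0n.
- by exists (gdist G); split=> // u v; exact: gdistP.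
- by rewrite size_enc_matrix; lia.
- by move=> i; rewrite size_enc_matrix; exact: st'E.
Qed.
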